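(* Let $X$ be a proper length space with locally unique geodesics. Suppose that every geodesic segment in $X$ is stable. Then for any two points $p,q\in X$ there is one and only one geodesic segment (up to reparameterization) between $p$ and $q$ in each homotopy class of curves connecting $p$ and $q$ (homotopies with fixed endpoints).
   Context: A metric space is proper if every closed ball in it is compact. A curve $\gamma$ in a length space is a geodesic if it is locally minimizing: every point $t_0$ in the domain of $\gamma$ has a neighborhood such that $\gamma$ restricted to that neighborhood is a shortest path. A geodesic segment is a geodesic defined on a compact interval. A length space $X$ has locally unique geodesics if every point of $X$ has a neighborhood such that any two points in this neighborhood are connected by a unique shortest path (up to reparameterization). A geodesic segment $\gamma\colon[a,b]\to X$ is stable if there is a neighborhood $U$ of $\gamma$, in the space of all curves in $X$ parameterized by $[a,b]$ equipped with the uniform topology, such that every curve $\gamma_1\in U$ connecting the same endpoints as $\gamma$ satisfies $\operatorname{length}(\gamma_1)>\operatorname{length}(\gamma)$ unless $\gamma_1$ is a reparameterization of $\gamma$. *)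

(* Defs.v *)
From mathcomp Require Import all_boot all_order all_algebra.
From mathcomp Require Import all_classical all_reals all_analysis.
Set Implicit Arguments.
Unset Strict Implicit.
Unset Printing Implicit Defensive.
Import Order.TTheory GRing.Theory Num.Theory.
Import numFieldTopology.Exports numFieldNormedType.Exports.
Local Open Scope classical_set_scope.
Local Open Scope ring_scope.

(* A parameterized curve is a triple (a, b, c) with a < b and c : R -> X
   continuous on [a, b].  The values of c outside [a, b] are irrelevant: no
   notion below depends on them. *)

Section Curves.
Context {R : realType} {X : metricType R}.
Implicit Types (a b : R) (c : R -> X) (p q : X).

Definition curve a b c : Prop :=
  a < b /\ {within `[a, b], continuous c}.

Definition curve_between a b c p q : Prop :=
  [/\ curve a b c, c a = p & c b = q].

Definition polygonal_length a b c (s : seq R) : R :=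
  \sum_(0 <= i < size s) mdist (c (nth b (a :: s) i)) (c (nth b s i)).

Definition curve_length a b c : \bar R :=
  ereal_sup [set (polygonal_length a b c s)%:E | s in [set s | itv_partition a b s]].

Definition change_of_parameter a b a' b' (phi : R -> R) : Prop :=
  [/\ {within `[a, b], continuous phi},
      {in `[a, b] &, {homo phi : s t / s <= t}},
      phi a = a' & phi b = b'].

(* Changes of parameter are monotone but need not be injective (a curve may
   pause), so the symmetric relation "same curve up to reparameterization" asks
   for a common reparameterization. *)
Definition reparameterization a b c a' b' c' : Prop :=
  exists phi phi' : R -> R,
    [/\ change_of_parameter 0 1 a b phi,
        change_of_parameter 0 1 a' b' phi' &
        {in `[0, 1], forall t, c (phi t) = c' (phi' t)}].

Definition shortest_path a b c : Prop :=
  curve a b c /\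
  forall a' b' c', curve_between a' b' c' (c a) (c b) ->
    (curve_length a b c <= curve_length a' b' c')%E.

(* Local minimality at every parameter value is meaningful only for
   parameterizations without pauses: by pausing at a corner, any broken geodesic
   would become locally minimizing.  Constant curves must still be allowed. *)
Definition pauseless a b c : Prop :=
  forall s t, a <= s -> s < t -> t <= b ->
    {in `[s, t], forall u, c u = c s} -> {in `[a, b], forall u, c u = c a}.

Definition locally_minimizing a b c : Prop :=
  forall t0, t0 \in `[a, b] -> exists s t,
    [/\ a <= s, s < t, t <= b, within `[a, b] (nbhs t0) `[s, t]%classic
      & shortest_path s t c].

Definition geodesic_segment a b c : Prop :=
  [/\ curve a b c, pauseless a b c & locally_minimizing a b c].

Definition stable a b c : Prop :=
  exists U : set (R -> X),
    nbhs (c : {uniform` `[a, b] -> X}) U /\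
    forall c1, U c1 -> curve_between a b c1 (c a) (c b) ->
      ~ reparameterization a b c a b c1 ->
      (curve_length a b c < curve_length a b c1)%E.

(* Homotopy relative to the endpoints p and q, after rescaling both domains
   affinely to [0, 1]. *)
Definition homotopic p q a b c a' b' c' : Prop :=
  exists H : R * R -> X,
    [/\ {within `[0, 1] `*` `[0, 1], continuous H},
        {in `[0, 1], forall t, H (0, t) = c (line_path a b t)},
        {in `[0, 1], forall t, H (1, t) = c' (line_path a' b' t)},
        {in `[0, 1], forall s, H (s, 0) = p} &
        {in `[0, 1], forall s, H (s, 1) = q}].

End Curves.

Section Spaces.
Context {R : realType} (X : metricType R).

Definition proper_space : Prop :=
  forall (x : X) (r : R), compact [set y : X | mdist x y <= r].

Definition length_space : Prop :=
  forall x y : X,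
    (mdist x y)%:E = ereal_inf [set l | exists a b c,
      curve_between a b c x y /\ l = curve_length a b c].

Definition locally_unique_geodesics : Prop :=
  forall x : X, exists2 U : set X, nbhs x U &
    forall y z, U y -> U z ->
      (exists a b c, curve_between a b c y z /\ shortest_path a b c) /\
      (forall a b c a' b' c',
        curve_between a b c y z -> shortest_path a b c ->
        curve_between a' b' c' y z -> shortest_path a' b' c' ->
        reparameterization a b c a' b' c').

End Spaces.

(* Main.v *)
Require Import Defs.
From mathcomp Require Import all_boot all_order all_algebra.
From mathcomp Require Import all_classical all_reals all_analysis.
From mathcomp Require Import ring lra.

(* The length functional is replaced by finite-dimensional approximations, as in
   Morse theory.  On a closed ball of a proper space short segments exist, are
   unique and depend continuously on their endpoints, so a tuple of points
   x_0 = p, ..., x_N = q with consecutive distances at most h spans a broken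
   geodesic.  Moving x_i to the midpoint of its two neighbours preserves the
   bound h and strictly decreases the energy, the sum of the squared distances,
   unless x_i already is that midpoint.  Hence the critical tuples are the samples
   of geodesics of constant speed, and stability makes each of them a strict local
   minimum of the energy.
   Existence: minimise the energy over the compact set of tuples whose broken
   geodesic lies in the given homotopy class.
   Uniqueness: a homotopy between two geodesics, sampled finely enough, is a path
   of tuples joining two critical ones.  By a mountain pass argument these
   coincide: otherwise the minimax level would carry a critical tuple that is not
   a strict local minimum. *)

Set Implicit Arguments.
Unset Strict Implicit.
Unset Printing Implicit Defensive.
Import Order.TTheory GRing.Theory Num.Theory.
Import numFieldTopology.Exports numFieldNormedType.Exports.
Local Open Scope classical_set_scope.
Local Open Scope ring_scope.
Local Notation dist := mdist.

(** * Mountain pass *)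

Section MountainPass.
Context {R : realType} {Y : topologicalType}.
Implicit Types (A B T : set Y) (x y : Y).

(** The radius below which segments are unique depends on the ball, while a tuple of N edges of
    length at most h can go as far as N h from p. Sampling a merely continuous curve more finely
    would let N h grow, and the choice of h would be circular. So the curve is sampled once, in M
    steps bounded by a fixed e, and each step is then cut geodesically into k equal parts. This
    keeps N h = M e, so the radius valid on the ball of radius (M + 1) e is known before k is
    chosen. Energy replaces length because stability is blind to reparameterizations: sliding nodes
    along a geodesic keeps the length, and only the energy singles out the evenly spaced tuple. The
    midpoint moves stand in for a gradient flow. All that is asked of them is to be continuous, not
    to raise the energy, and to keep it only at their fixed points. Minimax levels are defined by
    separating a sublevel set into two compact parts, not by paths: such separations extend to
    slightly higher levels by compactness and pull back along continuous maps. *)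

Lemma set0_not A x : A = set0 -> A x -> False.
Proof. by move=> ->. Qed.

(** Near-covering form of compactness, applied to the filter of small members of [F]: one [W] serves
    all points of [A] at once. *)
Lemma compact_avoid A (F : set_system Y) : ProperFilter F -> compact A ->
  (forall x, A x -> exists2 W, F W & nbhs x (~` W)) ->
  exists2 W, F W & A `<=` (~` W)°.
Proof.
move=> FF /compact_near_coveringP cA AF.
have := @cA (set Y) (powerset_filter_from F) (fun W x => nbhs x (~` W))
  (powerset_filter_from_filter FF).
case.
  move=> x /AF[W FW xW].
  exists ((~` W)°, [set V | F V /\ V `<=` W]) => /=.
    split; first by apply: nbhs_interior.
    exists [set V | F V /\ V `<=` W] => //; split; first by move=> V [].
      by move=> V V' [FV VW] FV' V'V; split=> // z /V'V/VW.
    by exists W; split.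
  move=> [z V] /= [zW [_ VW]]; apply: filterS zW => u /= nWu /VW; exact: nWu.
move=> G [GF Gdown [W GW]] GP; exists W; first exact: GF.
by move=> x /(GP W GW).
Qed.

(** Two rounds of [compact_avoid]: a point of [A] against [B], then [A] against the neighbourhood
    filter of [B]. *)
Lemma hausdorff_compact_sep A B : hausdorff_space Y -> compact A ->
  compact B -> A `&` B = set0 ->
  exists U V, [/\ open U, open V, A `<=` U, B `<=` V & U `&` V = set0].
Proof.
move=> HY cA cB AB.
have [->|/set0P B0] := eqVneq B set0.
  by exists setT, set0; split; [exact: openT|exact: open0| | |rewrite setI0].
have FB : ProperFilter (set_nbhs B) by exact: set_nbhs_pfilter.
have [x Ax|W BW AW] := @compact_avoid A (set_nbhs B) _ cA.
  have [y By|W xW BW] := @compact_avoid B (nbhs x) _ cB.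
    have xy : x != y.
      apply/eqP => xy; apply: (@set0_not _ x AB).
      by split=> //; rewrite xy.
    have := HY; rewrite open_hausdorff => /(_ _ _ xy) [[U V]] /=.
    rewrite !inE => -[xU yV] [oU oV UV]; exists U; first exact: open_nbhs_nbhs.
    apply: (@filterS _ _ _ V); last exact: open_nbhs_nbhs.
    by move=> z Vz Uz; apply: (@set0_not _ z UV).
  exists (~` W); last by rewrite setCK.
  by move=> y /BW.
have /set_nbhsP[V [oV BV VW]] := BW.
exists (~` W)°, V; split=> //; first exact: open_interior.
rewrite -subset0 => z [/interior_subset Wz /VW]; exact: Wz.
Qed.

Lemma compact_preimage {Z : topologicalType} (T S : set Y) (f : Y -> Z)
    (C : set Z) :
  {within T, continuous f} -> S `<=` T -> compact S -> closed C ->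
  compact (S `&` f @^-1` C).
Proof.
move=> cf ST cS cC.
have : closed (f @^-1` C : set (subspace S)).
  by apply: closed_comp => // x _; exact: (continuous_subspaceW ST cf).
move=> /closed_subspaceP[V cV VS].
by rewrite setIC -VS setIC; exact: compact_closedI.
Qed.

Definition sublevel T (E : Y -> R) c := T `&` [set x | E x <= c].

(** The parts may be larger than the sublevel set and must contain [x0] and [x1] even when these lie
    above level [c]. So the notion passes to lower levels and holds trivially below the minimum of
    [E]. *)
Definition split_at T (E : Y -> R) x0 x1 c := exists A B,
  [/\ compact A, compact B, A `&` B = set0, sublevel T E c `<=` A `|` B
    & A x0 /\ B x1].

(* Minimax: at the lowest level [l] whose sublevel set joins [x0] to [x1], the
   map [Phi] pushes everything but the isolated critical points below [l]. *)
Lemma mountain_pass T (E : Y -> R) (Phi : Y -> Y) x0 x1 G :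
  hausdorff_space Y -> compact T ->
  {within T, continuous E} -> {within T, continuous Phi} ->
  (forall x, T x -> T (Phi x)) ->
  (forall x, T x -> E (Phi x) <= E x) ->
  (forall x, T x -> E (Phi x) = E x -> Phi x = x) ->
  (forall x, T x -> Phi x = x ->
     \forall y \near x, T y -> y <> x -> E x < E y) ->
  Phi x0 = x0 -> Phi x1 = x1 ->
  connected G -> G `<=` T -> G x0 -> G x1 -> x0 = x1.
Proof.
move=> HY cT cE cPhi TPhi EPhi critP strict fx0 fx1 cG GT Gx0 Gx1.
apply: contrapT => x01.
have Tx0 := GT _ Gx0; have Tx1 := GT _ Gx1.
have T0 : T !=set0 by exists x0.
have Hclosed A : compact A -> closed A by exact: compact_closed.
have csub c : compact (sublevel T E c).
  apply: (compact_preimage (C := [set z : R | z <= c]) cE) => //.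
have splitW c c' : c <= c' -> split_at T E x0 x1 c' -> split_at T E x0 x1 c.
  move=> cc' [A [B [cA cB AB sAB xAB]]]; exists A, B; split=> // x [Tx /= Ex].
  by apply: sAB; split=> //=; exact: le_trans Ex cc'.
have [M _ ME] := compact_EVT_max T0 cT cE.
have [m _ mE] := compact_EVT_min T0 cT cE.
have TM : T `<=` sublevel T E (E M).
  by move=> x Tx; split=> //; apply: ME; rewrite inE.
(* At the maximum of [E] the sublevel set is all of [T], and the connected set [G] forbids a
   splitting. *)
have nsM : ~ split_at T E x0 x1 (E M).
  move=> [A [B [cA cB AB sAB [Ax0 Bx1]]]].
  have sepAB : separated A B.
    by split; rewrite -(closure_id _).1 //; exact: Hclosed.
  have [/(_ _ Gx1) Ax1|/(_ _ Gx0) Bx0] :=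
      connected_subset sepAB (subset_trans (subset_trans GT TM) sAB) cG.
    by apply: (@set0_not _ x1 AB).
  by apply: (@set0_not _ x0 AB).
pose S := [set c | ~ split_at T E x0 x1 c].
(* Below the minimum the sublevel set is empty and the two singletons split it. *)
have Slb : lbound S (E m).
  move=> c /= nc; rewrite leNgt; apply/negP => cm; apply: nc.
  exists [set x0], [set x1]; split => //; try exact: compact_set1.
    by rewrite -subset0 => z [-> /=]; exact: x01.
  move=> z [Tz /= Ez]; have := mE z; rewrite inE => /(_ Tz) /le_trans /(_ Ez).
  by rewrite leNgt cm.
have hiS : has_inf S by split; [exists (E M) | exists (E m)].
pose l := inf S.
have ltl c : c < l -> split_at T E x0 x1 c.
  move=> cl; apply: contrapT => nc.
  by move: cl; rewrite ltNge => /negP; apply; apply: ge_inf => //; exists (E m).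
(* A fixed point at level [l] or above is a strict local minimum, hence nothing else near it lies in
   the sublevel set of [l]. *)
have iso x : T x -> Phi x = x -> l <= E x ->
    exists U, [/\ open U, U x & U `&` sublevel T E l `<=` [set x]].
  move=> Tx px lx; have := strict x Tx px.
  rewrite -nbhs_nearE nbhsE => -[U [oU Ux] sU]; exists U; split=> // z [Uz [Tz /= zl]].
  apply: contrapT => zx; have := sU z Uz Tz zx.
  by rewrite ltNge (le_trans zl lx).
(* The infimum itself is not split: disjoint open neighbourhoods of a splitting at [l] still cover
   the sublevel set of some [c > l], because [E] has a minimum above [l] on the compact remainder of
   [T]. All levels up to [c] would then be split. *)
have nsl : ~ split_at T E x0 x1 l.
  move=> [A [B [cA cB AB sAB [Ax0 Bx1]]]].
  have [U [V [oU oV AU BV UV]]] := hausdorff_compact_sep HY cA cB AB.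
  have [c lc sc] : exists2 c, l < c & sublevel T E c `<=` U `|` V.
    pose K := T `&` ~` (U `|` V).
    have cK : compact K.
      by apply: compact_closedI => //; apply: open_closedC; exact: openU.
    have [K0|/set0P K0] := eqVneq K set0.
      exists (l + 1); first by rewrite ltrDl.
      move=> z [Tz _]; apply: contrapT => nz.
      by apply: (@set0_not _ z K0); split.
    have cEK : {within K, continuous E}.
      by apply: (continuous_subspaceW _ cE) => z [].
    have [k] := compact_EVT_min K0 cK cEK; rewrite inE => -[Tk nk] kE.
    have lk : l < E k.
      rewrite ltNge; apply/negP => kl; apply: nk.
      by have [/AU|/BV] := sAB k (conj Tk kl); [left|right].
    exists ((l + E k) / 2); first by rewrite midf_lt.
    move=> z [Tz /= zE]; apply: contrapT => nz.
    have := kE z; rewrite inE => /(_ (conj Tz nz)).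
    rewrite leNgt => /negP; apply; apply: le_lt_trans zE _.
    by rewrite midf_lt.
  have spc : split_at T E x0 x1 c.
    exists ((sublevel T E c `&` ~` V) `|` [set x0]).
    exists ((sublevel T E c `&` ~` U) `|` [set x1]).
    have nV0 : ~ V x0.
      by move=> Vx0; apply: (@set0_not _ x0 UV); split=> //; exact: AU.
    have nU1 : ~ U x1.
      by move=> Ux1; apply: (@set0_not _ x1 UV); split=> //; exact: BV.
    split.
    - apply: compactU; last exact: compact_set1.
      by apply: compact_closedI => //; exact: open_closedC.
    - apply: compactU; last exact: compact_set1.
      by apply: compact_closedI => //; exact: open_closedC.
    - rewrite -subset0 => z [] [[zc nVz]|->] [[zc' nUz]|] //.
      + by have [] := sc _ zc.
      + by move=> zx; move: nVz; rewrite zx; apply; exact: BV.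
      + by apply: nUz; exact: AU.
    - move=> z zc; have [Uz|Vz] := sc _ zc; [left|right]; left; split=> // Wz.
        by apply: (@set0_not _ z UV).
      by apply: (@set0_not _ z UV).
    - by split; right.
  have [c' Sc' lc'] := inf_lt hiS.1 lc.
  by apply: Sc'; exact: splitW (ltW lc') spc.
(* If [x0] were not strictly below [l], it could be cut off from the sublevel set as a singleton,
   splitting level [l]; likewise for [x1]. *)
have [lx0|x0l] := leP l (E x0).
  have [U [oU Ux0 sU]] := iso _ Tx0 fx0 lx0; apply: nsl.
  exists [set x0], ((sublevel T E l `&` ~` U) `|` [set x1]); split.
  - exact: compact_set1.
  - apply: compactU; last exact: compact_set1.
    by apply: compact_closedI => //; exact: open_closedC.
  - by rewrite -subset0 => z [-> []] // [].
  - move=> z zl; have [Uz|nUz] := pselect (U z); last by right; left.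
    by left; exact: sU.
  - by split=> //; right.
have [lx1|x1l] := leP l (E x1).
  have [U [oU Ux1 sU]] := iso _ Tx1 fx1 lx1; apply: nsl.
  exists ((sublevel T E l `&` ~` U) `|` [set x0]), [set x1]; split.
  - apply: compactU; last exact: compact_set1.
    by apply: compact_closedI => //; exact: open_closedC.
  - exact: compact_set1.
  - rewrite -subset0 => z [[[_ nUz]|->] zx]; last exact: x01.
    by apply: nUz; rewrite zx.
  - move=> z zl; have [Uz|nUz] := pselect (U z); last by left; left.
    by right; exact: sU.
  - by split=> //; right.
have cEPhi : {within T, continuous (E \o Phi)}.
  apply/subspace_continuousP => z Tz.
  have /subspace_continuousP/(_ _ Tz) cz := cPhi.
  have /subspace_continuousP/(_ _ (TPhi _ Tz)) cfz := cE.
  apply: (cvg_trans _ cfz) => W /= nW.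
  have := cz _ nW; rewrite /= !nbhs_simpl /within /= => h.
  by apply: filterS h => u hu Tu; apply: hu => //; exact: TPhi.
(* The points that [Phi] fails to push below [l]. They are fixed, have level exactly [l] and are
   isolated in the sublevel set. *)
pose K := sublevel T E l `&` [set x | l <= E (Phi x)].
have cK : compact K.
  apply: (compact_preimage (C := [set z : R | l <= z]) cEPhi) => //.
  - by move=> z [].
have Kcrit x : K x -> Phi x = x /\ E x = l.
  move=> [[Tx /= xl] /= lx].
  have e1 : E (Phi x) = E x by apply/eqP; rewrite eq_le EPhi //= (le_trans xl lx).
  by split; [exact: critP | apply/eqP; rewrite eq_le xl -e1 lx].
(* An open set around [K] that meets the sublevel set only in [K]; removing it leaves a compact set,
   on which [E \o Phi] has a maximum below [l]. *)
pose O := [set x | sublevel T E l x -> K x]°.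
have KO : K `<=` O.
  move=> x Kx; have [px ex] := Kcrit x Kx; have [[Tx _] _] := Kx.
  have lx : l <= E x by rewrite ex.
  have [U [oU Ux sU]] := iso x Tx px lx.
  rewrite /O /interior nbhsE; exists U => // z Uz zl.
  by have -> := sU z (conj Uz zl).
pose T' := sublevel T E l `&` ~` O.
have cT' : compact T'.
  by apply: compact_closedI => //; apply: open_closedC; exact: open_interior.
have T'T : T' `<=` T by move=> z [[]].
have nKT x : E x < l -> T x -> Phi x = x -> T' x.
  move=> xl Tx px; split; first by split=> //=; exact: ltW.
  move=> /interior_subset /= /(_ (conj Tx (ltW xl))) /Kcrit [_ xe].
  by move: xl; rewrite xe ltxx.
have T'0 : T' !=set0 by exists x0; exact: nKT.
have [k] := compact_EVT_max T'0 cT' (continuous_subspaceW T'T cEPhi).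
rewrite inE /= => -[Tk nOk] kE.
have kl : E (Phi k) < l.
  by rewrite ltNge; apply/negP => lk; apply: nOk; apply: KO; split.
(* The splitting at this lower level is pulled back along [Phi]. The isolated set [K] can join
   either side; it is put with [B]. *)
have [A [B [cA cB AB sAB [Ax0 Bx1]]]] := ltl _ kl.
apply: nsl; exists (T' `&` Phi @^-1` A), ((T' `&` Phi @^-1` B) `|` K); split.
- by apply: (compact_preimage cPhi) => //; exact: Hclosed.
- apply: compactU => //.
  by apply: (compact_preimage cPhi) => //; exact: Hclosed.
- rewrite -subset0 => z [[T'z Az]] [[_ Bz]|Kz].
    by apply: (@set0_not _ (Phi z) AB).
  by case: T'z => _; apply; exact: KO.
- move=> z zl; have [Oz|nOz] := pselect (O z).
    by right; right; exact: (interior_subset Oz).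
  have T'z : T' z by [].
  have [] // := sAB (Phi z).
  + split; first by apply: TPhi; exact: T'T.
    by apply: kE; rewrite inE.
  + by move=> Az; left.
  + by move=> Bz; right; left.
- split; first by split; [exact: nKT|rewrite /= fx0].
  by left; split; [exact: nKT|rewrite /= fx1].
Qed.

End MountainPass.

(** * Distances, truncation and gluing of continuous maps *)

Section Basics.
Context {R : realType} {X : metricType R}.
Implicit Types (a b s t : R) (c : R -> X) (x y z m : X).

Lemma dist_eq0 x y : dist x y <= 0 -> x = y.
Proof.
by move=> xy; apply: mdist_positivity; apply/eqP; rewrite eq_le xy mdist_ge0.
Qed.

Lemma dist_quad x y x' y' :
  `|dist x y - dist x' y'| <= dist x x' + dist y y'.
Proof.
have h1 := metric_triangle x x' y; have h2 := metric_triangle x' y' y.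
have h3 := metric_triangle x' x y'; have h4 := metric_triangle x y y'.
have h5 := metric_sym x x'; have h6 := metric_sym y y'.
by rewrite ler_norml; apply/andP; split; lra.
Qed.

Lemma cvg_metricP {T : Type} (F : set_system T) (FF : Filter F) (f : T -> X) y :
  (forall e : R, 0 < e -> \forall t \near F, dist y (f t) < e) -> f @ F --> y.
Proof. by move=> h; apply/metricType_numDomainType.cvgrPdist_lt. Qed.

Lemma cvg_metric_near {T : Type} (F : set_system T) (FF : Filter F)
    (f : T -> X) y (e : R) :
  f @ F --> y -> 0 < e -> \forall t \near F, dist y (f t) < e.
Proof. by move=> /metricType_numDomainType.cvgrPdist_lt; exact. Qed.

Lemma cvg_dist {T : Type} (F : set_system T) (FF : Filter F) (f g : T -> X) x y :
  f @ F --> x -> g @ F --> y -> dist (f t) (g t) @[t --> F] --> dist x y.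
Proof.
move=> fx gy; apply/cvgrPdist_lt => e e0.
have e2 : 0 < e / 2 by rewrite divr_gt0.
have := cvg_metric_near FF gy e2; apply: filterS2 (cvg_metric_near FF fx e2).
by move=> t h1 h2; apply: le_lt_trans (dist_quad _ _ _ _) _; lra.
Qed.

Lemma near_metric x (e : R) : 0 < e -> \forall y \near x, dist x y < e.
Proof. exact: (@cvg_metric_near _ (nbhs x) _ id x e (@cvg_id _ _)). Qed.

Lemma nbhs_metric x (U : set X) : nbhs x U ->
  exists2 e : R, 0 < e & forall y, dist x y < e -> U y.
Proof.
move=> /metricType_numDomainType.nbhs_mdistP [e /= e0 eU].
by exists e => // y xy; exact: eU.
Qed.

Definition clamp a b t : R := Order.max a (Order.min b t).

Lemma clamp_in a b t : a <= b -> a <= clamp a b t <= b.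
Proof. by move=> ab; rewrite /clamp le_max lexx /= ge_max ab /= ge_min lexx. Qed.

Lemma clamp_id a b t : a <= t -> t <= b -> clamp a b t = t.
Proof. by move=> at_ tb; rewrite /clamp min_r // max_r. Qed.

Lemma clamp_l a b t : a <= b -> t <= a -> clamp a b t = a.
Proof. by move=> ab ta; rewrite /clamp min_r ?max_l // (le_trans ta). Qed.

Lemma clamp_r a b t : a <= b -> b <= t -> clamp a b t = b.
Proof. by move=> ab bt; rewrite /clamp min_l // max_r. Qed.

Lemma continuous_clamp a b : continuous (clamp a b).
Proof.
move=> t; apply: (@max_fun_continuous _ _ _ (fun=> a) (fun u => Order.min b u)).
  by move=> ?; exact: cvg_cst.
apply: (@min_fun_continuous _ _ _ (fun=> b) id) => ? //; exact: cvg_cst.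
Qed.

Lemma continuous_comp_within {T U V : topologicalType} (A : set U)
    (f : U -> V) (g : T -> U) :
  {within A, continuous f} -> continuous g -> (forall u, A (g u)) ->
  continuous (f \o g).
Proof.
move=> /subspace_continuousP cf cg gA x.
apply: cvg_trans (cf _ (gA x)) => W /= nW.
have h := cg x _ nW; apply: (@filterS _ (nbhs x) _ _ _ _ h) => u hu; exact: hu (gA u).
Qed.

Lemma continuous_clamped a b c : a <= b -> {within `[a, b], continuous c} ->
  continuous (c \o clamp a b).
Proof.
move=> ab cc; apply: continuous_comp_within.
- exact: cc.
- exact: continuous_clamp.
move=> t /=; by rewrite in_itv /= clamp_in.
Qed.

Lemma continuous_glue {T U : topologicalType} (f g : T -> U) (h : T -> R) :
  continuous f -> continuous g -> continuous h ->
  (forall u, h u = 0 -> f u = g u) ->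
  continuous (fun u => if h u <= 0 then f u else g u).
Proof.
move=> cf cg ch fg u0 W /=.
have [hx|hx|hx] := ltgtP (h u0) 0.
- move=> nW; have := cvgr_lt _ (ch u0) _ hx => hlt.
  apply: (@filterS2 _ (nbhs u0) _ _ _ _ _ (cf u0 W nW) (hlt _)).
  by move=> u Wu hu /=; rewrite ltW.
- move=> nW; have := cvgr_gt _ (ch u0) _ hx => hgt.
  apply: (@filterS2 _ (nbhs u0) _ _ _ _ _ (cg u0 W nW) (hgt _)).
  by move=> u Wu hu /=; rewrite leNgt hu.
- move=> nW; have nW' : nbhs (g u0) W by rewrite -fg.
  apply: (@filterS2 _ (nbhs u0) _ _ _ _ _ (cf u0 W nW) (cg u0 W nW')).
  move=> u Wf Wg /=.
  by case: ifP.
Qed.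

Lemma IVT_curve (f : R -> R) a b v : a <= b -> {within `[a, b], continuous f} ->
  f a <= v -> v <= f b -> exists2 t, a <= t <= b & f t = v.
Proof.
move=> ab cf av vb; have [] := @IVT R f a b v ab cf.
  by rewrite ge_min av le_max vb orbT.
by move=> t; rewrite in_itv /= => tab <-; exists t.
Qed.

End Basics.

(** * From local to global on intervals, and Lebesgue numbers *)

Section Chains.
Context {R : realType}.
Implicit Types (a b s t u : R) (Q : R -> R -> Prop).

(** Induction on the number of pieces, cutting at [tau N] an interval that crosses it. [Q] will be
    an additive estimate or identity, which this carries from small scales to the whole interval. *)
Lemma chain_pieces Q (tau : nat -> R) (N : nat) :
  (forall s t u, s <= t -> t <= u -> Q s t -> Q t u -> Q s u) ->
  (forall s, tau 0%N <= s -> s <= tau N -> Q s s) ->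
  (forall i, (i < N)%N -> tau i <= tau i.+1) ->
  (forall i s t, (i < N)%N -> tau i <= s -> s <= t -> t <= tau i.+1 -> Q s t) ->
  forall s t, tau 0%N <= s -> s <= t -> t <= tau N -> Q s t.
Proof.
move=> Qtr; elim: N => [|N IH] Qxx tau_nd Qi s t s0 st tN.
  have -> : t = s by apply/eqP; rewrite eq_le st andbT (le_trans tN).
  by apply: Qxx => //; exact: le_trans tN.
have nd : tau N <= tau N.+1 by exact: tau_nd.
have IH' : forall s t, tau 0%N <= s -> s <= t -> t <= tau N -> Q s t.
  apply: IH => [u u0 uN|i iN|i u v iN]; first by apply: Qxx => //; lra.
    by apply: tau_nd; exact: ltnW.
  by apply: Qi; exact: ltnW.
have [tN'|tN'] := leP t (tau N); first exact: IH'.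
have [sN|sN] := leP (tau N) s; first exact: (Qi N).
apply: (Qtr _ (tau N)); try lra.
- by apply: IH' => //; lra.
- by apply: (Qi N) => //; lra.
Qed.

Lemma chain_local Q a b (delta : R) : 0 < delta ->
  (forall s t u, s <= t -> t <= u -> Q s t -> Q t u -> Q s u) ->
  (forall s t, a <= s -> s <= t -> t <= b -> t <= s + delta -> Q s t) ->
  forall s t, a <= s -> s <= t -> t <= b -> Q s t.
Proof.
move=> d0 Qtr Qd s t a_s st tb.
have [n nP] : exists n : nat, b - a <= n%:R * delta.
  exists (Num.bound ((b - a) / delta)).
  rewrite -ler_pdivrMr //; apply/ltW.
  by apply: archi_boundP; apply: divr_ge0; [lra|exact: ltW].
pose tau i := a + i%:R * delta.
have := @chain_pieces (fun s t => t <= b -> Q s t) tau n.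
apply => //; rewrite /tau.
- move=> u v w uv vw Quv Qvw wb; apply: (Qtr _ v) => //; [apply: Quv; lra|exact: Qvw].
- by move=> u u0 un ub; apply: Qd => //; [rewrite mul0r addr0 in u0|lra].
- by move=> i _; rewrite -natr1 mulrDl; lra.
- move=> i u v _ iu uv vi vb; apply: Qd => //.
    have : 0 <= i%:R * delta by rewrite mulr_ge0 // ltW.
    lra.
  by move: vi; rewrite -natr1 mulrDl; lra.
- by rewrite mul0r addr0.
- by lra.
Qed.

(** Lebesgue's covering lemma, for a relation between nearby points in place of a cover. *)
Lemma lebesgue_number {Y : metricType R} (K : set Y) (Q : Y -> Y -> Prop) :
  compact K ->
  (forall x, K x -> exists2 e : R, 0 < e &
     forall u v : Y, K u -> dist x u < e -> dist x v < e -> Q u v) ->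
  exists2 delta : R, 0 < delta &
    forall u v : Y, K u -> dist u v < delta -> Q u v.
Proof.
move=> /compact_near_coveringP cK KQ.
have := cK R (0:R)^'+ (fun (d : R) (u : Y) => K u -> forall v, dist u v < d -> Q u v) _.
case.
  move=> x /KQ[e e0 eQ].
  exists ([set u : Y | dist x u < e / 2], [set d : R | 0 < d < e / 2]) => /=.
    split; first by apply: near_metric; lra.
    near=> d; apply/andP; split; near: d; first exact: nbhs_right_gt.
    by apply: nbhs_right_lt; lra.
  move=> [u d] /= [xu /andP[d0 de]] Ku v uv; apply: eQ => //; first lra.
  by have := metric_triangle x u v; lra.
rewrite /= => d0 [/= d0P dP].
pose d := d0 / 2.
exists d; first by rewrite /d; lra.
move=> u v Ku uv; apply: (dP d _ _ u Ku Ku v uv); rewrite /d /=.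
  by rewrite sub0r normrN gtr0_norm; lra.
by lra.
Unshelve. all: by end_near. Qed.

Lemma small_inverse (e : R) : 0 < e -> exists2 n : nat, (1 < n)%N & n%:R^-1 <= e.
Proof.
move=> e0; exists (Num.bound e^-1).+2 => //.
rewrite invf_ple ?posrE ?ltr0n //.
have : e^-1 < (Num.bound e^-1)%:R by apply: archi_boundP; rewrite ltW // invr_gt0.
by move=> h; apply: le_trans (ltW h) _; rewrite ler_nat (leqW (leqnSn _)).
Qed.

Lemma real_dist (s t : R^o) : dist s t = `|s - t|.
Proof. by rewrite distrC. Qed.

Lemma itv_lebesgue_number a b (Q : R -> R -> Prop) :
  (forall x, a <= x <= b -> exists2 e : R, 0 < e &
     forall u v, a <= u <= b -> `|x - u| < e -> `|x - v| < e -> Q u v) ->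
  exists2 delta : R, 0 < delta &
    forall u v, a <= u <= b -> `|u - v| < delta -> Q u v.
Proof.
move=> abQ.
have [|d d0 dQ] := @lebesgue_number R^o `[a, b]%classic Q (@segment_compact R a b).
  move=> x /=; rewrite in_itv /= => /abQ[e e0 eQ]; exists e => // u v.
  by rewrite /= in_itv !real_dist; exact: eQ.
by exists d => // u v uab uv; apply: dQ; rewrite /= ?in_itv ?real_dist.
Qed.

Lemma itv_uniform_continuity a b (f : R -> R) (e : R) :
  {within `[a, b], continuous f} -> 0 < e ->
  exists2 d : R, 0 < d & forall s t, a <= s <= b -> a <= t <= b ->
    `|s - t| < d -> `|f s - f t| < e.
Proof.
move=> cf e0.
have [|d d0 dP] := @itv_lebesgue_number a b
    (fun s t => a <= t <= b -> `|f s - f t| < e).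
- move=> u uab; have /subspace_continuousP/(_ u) := cf.
  rewrite /= in_itv /= => /(_ uab) /cvgrPdist_lt/(_ (e / 2)).
  rewrite divr_gt0 // => /(_ isT).
  rewrite near_withinE => /nbhs_ballP[d /= d0 dP]; exists d => // s t sab us ut tab.
  have h1 : `|f u - f s| < e / 2 by apply: dP; rewrite //= in_itv.
  have h2 : `|f u - f t| < e / 2 by apply: dP; rewrite //= in_itv.
  have := ler_distD (f u) (f s) (f t).
  by rewrite (distrC (f s) (f u)); lra.
- by exists d => // s t sab tab st; exact: dP.
Qed.

End Chains.

(** * Lengths and shortest paths *)

Section Lengths.
Context {R : realType} {X : metricType R}.
Implicit Types (a b s t u : R) (c : R -> X) (x y z m : X) (A : R -> R).

Fixpoint path_length c a (s : seq R) : R :=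
  if s is x :: s' then dist (c a) (c x) + path_length c x s' else 0.

Lemma polygonal_lengthE a b c (s : seq R) :
  polygonal_length a b c s = path_length c a s.
Proof.
rewrite /polygonal_length; elim: s a => [|x s IH] a /=; first by rewrite big_nil.
by rewrite big_nat_recl //= -IH.
Qed.

(** [itv_partition] asks for strictly increasing nodes; repeated nodes contribute nothing and are
    dropped. *)
Lemma path_length_le_curve_length a b c (s : seq R) :
  path <=%R a s -> last a s = b ->
  ((path_length c a s)%:E <= curve_length a b c)%E.
Proof.
move=> pa la.
have [s' [ps' ls'] ->] : exists2 s', path <%R a s' /\ last a s' = b &
    path_length c a s = path_length c a s'.
  elim: s a pa la => [|x s IH] a /=; first by move=> _ ab; exists [::].
  move=> /andP[ax ps] ls; have [s' [ps' ls'] e] := IH x ps ls.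
  move: ax; rewrite le_eqVlt => /orP[/eqP ax|ax].
    by exists s'; rewrite ax // mdistxx add0r.
  by exists (x :: s'); rewrite /= ?ax // e.
rewrite -(polygonal_lengthE a b); apply: ereal_sup_ubound; exists s' => //.
by split=> //; apply/eqP.
Qed.

Lemma curve_length_le a b c A :
  (forall s t, a <= s -> s <= t -> t <= b -> dist (c s) (c t) <= A t - A s) ->
  (curve_length a b c <= (A b - A a)%:E)%E.
Proof.
move=> cA; apply: ge_ereal_sup => _ [s [ps /eqP ls] <-].
rewrite lee_fin polygonal_lengthE.
elim: s a cA ps ls => [|x s IH] a cA /=; first by move=> _ ->; rewrite subrr.
move=> /andP[ax ps] ls.
have xb : x <= b.
  have ips : itv_partition x b s by split=> //; apply/eqP.
  exact: itv_partition_le ips.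
have : path_length c x s <= A b - A x.
  by apply: IH => // u v xu; apply: cA; rewrite (le_trans _ xu) ?ltW.
by have := cA a x (lexx a) (ltW ax) xb; lra.
Qed.

(** Every arc of [c] realises the distance of its ends, and [A] is an arclength function. This is
    the working form of being a shortest path. *)
Definition arclength_on a b c A := forall s t,
  a <= s -> s <= t -> t <= b -> dist (c s) (c t) = A t - A s.

Lemma arclength_abs a b c A s t : arclength_on a b c A ->
  a <= s <= b -> a <= t <= b -> dist (c s) (c t) = `|A t - A s|.
Proof.
move=> cA /andP[a_s sb] /andP[a_t tb].
have [st|/ltW ts] := leP s t.
  by rewrite -cA // ger0_norm ?mdist_ge0.
by rewrite distrC -cA // ger0_norm ?mdist_ge0 // metric_sym.
Qed.

(** In a length space the length of a shortest path is the distance of its ends, so the triangle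
    inequalities through [c s] and [c t] are equalities. *)
Lemma shortest_path_arclength a b c : length_space X -> shortest_path a b c ->
  exists A, arclength_on a b c A.
Proof.
move=> Xl [[ab cc] cmin]; exists (fun t => dist (c a) (c t)) => s t a_s st tb.
have : (curve_length a b c <= (dist (c a) (c b))%:E)%E.
  by rewrite Xl; apply: le_ereal_inf_tmp => _ [a' [b' [c' [cb ->]]]]; exact: cmin.
have ss : path <=%R a [:: s; t; b] by rewrite /= a_s st tb.
have := path_length_le_curve_length c ss erefl => /le_trans h /h.
rewrite lee_fin /= addr0.
have := metric_triangle (c a) (c t) (c b).
have := metric_triangle (c a) (c s) (c t).
by move=> h1 h2 h3; apply/eqP; rewrite eq_le; apply/andP; split; lra.
Qed.

(** The length is at most the distance of the ends, which bounds the length of every competitor from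
    below. *)
Lemma arclength_shortest_path a b c A :
  curve a b c -> arclength_on a b c A -> shortest_path a b c.
Proof.
move=> cc cA; split=> // a' b' c' [[ab' cc'] ca' cb'].
have ab : a <= b by case: cc => /ltW.
apply: (@le_trans _ _ (A b - A a)%:E).
  by apply: curve_length_le => s t a_s st tb; rewrite cA.
rewrite -cA // -ca' -cb'.
have ss : path <=%R a' [:: b'] by rewrite /= ltW.
have := path_length_le_curve_length c' ss erefl.
by rewrite /= addr0.
Qed.

(** Only upper bounds, the form easiest to verify; the triangle inequality turns both into
    equalities. *)
Definition between s x y m :=
  dist x m <= s * dist x y /\ dist m y <= (1 - s) * dist x y.

Lemma between_eq s x y m : between s x y m ->
  dist x m = s * dist x y /\ dist m y = (1 - s) * dist x y.
Proof.
move=> [h1 h2]; have h := metric_triangle x m y.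
by split; apply/eqP; rewrite eq_le; apply/andP; split=> //; lra.
Qed.

(** Uniqueness of short segments in terms of points: with no curves and no reparameterizations
    involved, compactness arguments apply directly. *)
Definition has_unique_segment x y := forall s, 0 <= s <= 1 ->
  exists2 m, between s x y m & forall m', between s x y m' -> m' = m.

Lemma arclength_between c A s : continuous c -> arclength_on 0 1 c A ->
  0 <= s <= 1 -> exists m, between s (c 0) (c 1) m.
Proof.
move=> cc cA /andP[s0 s1].
have [t /andP[t0 t1] tP] : exists2 t, 0 <= t <= 1 &
    dist (c 0) (c t) = s * dist (c 0) (c 1).
  apply: (@IVT_curve R (fun t => dist (c 0) (c t))) => //.
  - apply: continuous_subspaceT => t.
    by apply: cvg_dist; [exact: cvg_cst|exact: cc].
  - by rewrite mdistxx mulr_ge0 // mdist_ge0.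
  - by rewrite ler_piMl // mdist_ge0.
exists (c t); split; first by rewrite tP.
move: tP; rewrite !cA //; lra.
Qed.

(** Equality in the triangle inequality at the junction makes the concatenation a shortest path. The
    junction is placed at parameter 1. *)
Lemma concat_arclength c1 c2 A1 A2 : continuous c1 -> continuous c2 ->
  arclength_on 0 1 c1 A1 -> arclength_on 0 1 c2 A2 -> c1 1 = c2 0 ->
  dist (c1 0) (c1 1) + dist (c2 0) (c2 1) = dist (c1 0) (c2 1) ->
  exists2 c, curve_between 0 2 c (c1 0) (c2 1) &
    c 1 = c1 1 /\ exists A, arclength_on 0 2 c A.
Proof.
move=> cc1 cc2 cA1 cA2 c12 dc.
exists (fun t => if t - 1 <= 0 then c1 t else c2 (t - 1)).
  split=> /=; last 2 first.
  - by rewrite ifT //; lra.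
  - by rewrite ifF; [congr c2; lra|apply/negbTE; rewrite -ltNge; lra].
  split; first by [].
  apply: continuous_subspaceT.
  have cB : continuous (fun t : R => t - 1).
    by move=> t; apply: cvgB; [exact: cvg_id|exact: cvg_cst].
  apply: (@continuous_glue R _ _ c1 (fun t => c2 (t - 1)) (fun t => t - 1)) => //.
    by move=> t; apply: (@continuous_comp _ _ _ (fun t : R => t - 1) c2); [exact: cB|exact: cc2].
  by move=> u u0; rewrite u0 -c12; congr c1; lra.
split; first by rewrite subrr lexx.
exists (fun t => if t - 1 <= 0 then A1 t else A1 1 + (A2 (t - 1) - A2 0)).
move=> s t s0 st t2; case: (leP (t - 1) 0) => t1.
  have -> : s - 1 <= 0 by lra.
  by apply: cA1; lra.
case: (leP (s - 1) 0) => s1; last first.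
  by rewrite cA2; lra.
have e1 : dist (c1 s) (c1 1) = A1 1 - A1 s by apply: cA1; lra.
have e2 : dist (c2 0) (c2 (t - 1)) = A2 (t - 1) - A2 0 by apply: cA2; lra.
have e3 : dist (c1 0) (c1 s) = A1 s - A1 0 by apply: cA1; lra.
have e4 : dist (c2 (t - 1)) (c2 1) = A2 1 - A2 (t - 1) by apply: cA2; lra.
have e5 : dist (c1 0) (c1 1) = A1 1 - A1 0 by apply: cA1; lra.
have e6 : dist (c2 0) (c2 1) = A2 1 - A2 0 by apply: cA2; lra.
have t3 := metric_triangle (c1 s) (c1 1) (c2 (t - 1)).
have t4 := metric_triangle (c1 0) (c1 s) (c2 1).
have t5 := metric_triangle (c1 s) (c2 (t - 1)) (c2 1).
move: t3; rewrite {2}c12 => t3.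
by apply/eqP; rewrite eq_le; apply/andP; split; lra.
Qed.

Lemma continuous_line_path a b : continuous (line_path a b : R -> R).
Proof.
move=> t; rewrite /line_path.
apply: cvgD; apply: cvgM; try exact: cvg_cst; last exact: cvg_id.
by apply: cvgB; [exact: cvg_cst|exact: cvg_id].
Qed.

Lemma line_path_clamp a b t : a <= b ->
  a <= line_path a b (clamp 0 1 t) <= b.
Proof.
move=> ab; have /andP[h0 h1] := clamp_in t (@ler01 R).
by rewrite /line_path; apply/andP; split; nra.
Qed.

Lemma line_path_homo a b s t : a <= b -> s <= t ->
  line_path a b s <= line_path a b t.
Proof. by move=> ab st; rewrite /line_path; nra. Qed.

Lemma shortest_path_unit a b c : length_space X -> shortest_path a b c ->
  exists2 c1 : R -> X, [/\ continuous c1, c1 0 = c a & c1 1 = c b] &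
    exists A, arclength_on 0 1 c1 A.
Proof.
move=> Xl cs; have [A cA] := shortest_path_arclength Xl cs.
case: cs => -[ab cc] _.
have cl t : 0 <= t -> t <= 1 -> clamp 0 1 t = t by exact: clamp_id.
exists (fun t => c (line_path a b (clamp 0 1 t))).
  split; last 2 first.
  - by rewrite cl ?line_path0.
  - by rewrite cl ?line_path1.
  apply: (continuous_comp_within cc) => [t|t].
    apply: (@continuous_comp _ _ _ (clamp 0 1) (line_path a b)).
      exact: continuous_clamp.
    exact: continuous_line_path.
  by rewrite /= in_itv /= line_path_clamp ?ltW.
exists (fun t => A (line_path a b t)) => s t s0 st t1.
rewrite !cl //; [|lra..].
have := line_path_clamp s (ltW ab); have := line_path_clamp t (ltW ab).
rewrite !cl //; [|lra..] => /andP[h1 h2] /andP[h3 h4].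
by apply: cA => //; apply: line_path_homo; [exact: ltW|].
Qed.

(** Two points [m] and [m'] of the same ratio lie on shortest paths [k] and [k'] from [y] to [z].
    These are reparameterizations of each other, so [k'] passes through [m] as well; being equally
    far from [y], both points coincide. *)
Lemma local_unique_segment x : length_space X -> locally_unique_geodesics X ->
  exists2 e : R, 0 < e & forall y z, dist x y < e -> dist x z < e ->
    has_unique_segment y z.
Proof.
move=> Xl Xu; have [U /nbhs_metric[rho rho0 rU] UP] := Xu x.
have seg y z : dist x y < rho -> dist x z < rho ->
    exists2 c : R -> X, [/\ continuous c, c 0 = y & c 1 = z] &
      exists A, arclength_on 0 1 c A.
  move=> /rU Uy /rU Uz; have [[a [b [c [[_ ca cb] cs]]]] _] := UP y z Uy Uz.
  have [c1 [cc1 c10 c11] cA] := shortest_path_unit Xl cs.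
  by exists c1 => //; split=> //; rewrite ?c10 ?c11.
(* A point between [y] and [z] is less than [rho / 3 + 2 * rho / 3] away from [x], so it stays where
   shortest paths are available. *)
exists (rho / 3); first by lra.
move=> y z xy xz s s01.
have yz : dist y z < 2 * rho / 3.
  by have := metric_triangle y x z; rewrite (metric_sym y x); lra.
have [||c [cc c0 c1] [A cA]] := seg y z; [lra..|].
have [m mP] := arclength_between cc cA s01.
rewrite c0 c1 in mP.
have through m' : between s y z m' -> exists2 c, curve_between 0 2 c y z &
    c 1 = m' /\ exists A, arclength_on 0 2 c A.
  move=> bm; have [h1 h2] := between_eq bm.
  have xm : dist x m' < rho.
    have := metric_triangle x y m'; have := mdist_ge0 y z; nra.
  have [||c1' [cc1 c10 c11] [A1 cA1]] := seg y m'; [lra..|].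
  have [||c2' [cc2 c20 c21] [A2 cA2]] := seg m' z; [lra..|].
  have := concat_arclength cc1 cc2 cA1 cA2.
  rewrite c10 c11 c20 c21; apply=> //.
  by rewrite h1 h2; lra.
exists m => // m' m'P.
have [k ck [k1 [B kB]]] := through m mP.
have [k' ck' [k'1 [B' kB']]] := through m' m'P.
have Uy : U y by apply: rU; lra.
have Uz : U z by apply: rU; lra.
have [_ /(_ 0 2 k 0 2 k' ck)] := UP y z Uy Uz.
have sk : shortest_path 0 2 k.
  by case: ck => ck _ _; exact: arclength_shortest_path ck kB.
have sk' : shortest_path 0 2 k'.
  by case: ck' => ck' _ _; exact: arclength_shortest_path ck' kB'.
move=> /(_ sk ck' sk') [phi [phi' [[cphi _ phi0 phi1] [cphi' mphi' phi'0 phi'1] kk]]].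
have [|||u /andP[u0 u1] uP] := @IVT_curve R phi 0 1 1 _ cphi.
- by [].
- by rewrite phi0.
- by rewrite phi1; lra.
have ui : u \in `[0, 1] by rewrite in_itv /= u0.
have := kk u ui; rewrite uP k1 => mE.
have pu : 0 <= phi' u <= 2.
  by rewrite -{1}phi'0 -phi'1 !mphi' ?in_itv /= ?lexx ?ler01.
have k'0 : k' 0 = y by case: ck'.
have [e1 _] := between_eq mP; have [e2 _] := between_eq m'P.
apply: dist_eq0; rewrite mE -k'1.
have h : dist (k' 0) (k' (phi' u)) = dist (k' 0) (k' 1) by rewrite -mE k'1 k'0 e1.
have i0 : 0 <= (0 : R) <= 2 by apply/andP; split; lra.
have i1 : 0 <= (1 : R) <= 2 by apply/andP; split; lra.
have d1 := kB' 0 1 (lexx 0) ler01 (ltW (ltr1n R 2)).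
have d2 := kB' 0 (phi' u) (lexx 0) (proj1 (andP pu)) (proj2 (andP pu)).
rewrite (arclength_abs kB' i1 pu); rewrite d1 d2 in h.
by rewrite (_ : _ - _ = 0) ?normr0 //; lra.
Qed.

Lemma uniform_unique_segment p (rho : R) : proper_space X ->
  length_space X -> locally_unique_geodesics X ->
  exists2 r : R, 0 < r & forall x y, dist p x <= rho -> dist x y <= r ->
    has_unique_segment x y.
Proof.
move=> Xp Xl Xu.
have [|d d0 dP] := lebesgue_number (Q := has_unique_segment) (Xp p rho).
  move=> x _; have [e e0 eP] := local_unique_segment x Xl Xu.
  by exists e => // u v _; exact: eP.
exists (d / 2); first by lra.
by move=> x y px xy; apply: dP => //; lra.
Qed.

End Lengths.

(** * The point of given ratio on a short segment, and its continuity *)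

Section Segments.
Context {R : realType} {X : metricType R}.
Implicit Types (s t u : R) (x y m p : X) (rho r : R).

(** The default [x] is taken only when no point of ratio [s] exists. *)
Definition gam x y s : X := xget x [set m | between s x y m].

Definition segments_on p rho r := forall x y, dist p x <= rho ->
  dist x y <= r -> has_unique_segment x y.

Section Good.
Context (p : X) (rho r : R) (good : segments_on p rho r).

Lemma gam_between x y s : dist p x <= rho -> dist x y <= r -> 0 <= s <= 1 ->
  between s x y (gam x y s).
Proof.
move=> px xy s01; have [m mP _] := good px xy s01.
by rewrite /gam; case: xgetP => [m' _ //|/(_ m)].
Qed.

Lemma gam_unique x y s m : dist p x <= rho -> dist x y <= r -> 0 <= s <= 1 ->
  between s x y m -> m = gam x y s.
Proof.
move=> px xy s01 bm; have [m' _ m'P] := good px xy s01.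
by rewrite (m'P _ bm); apply/esym/m'P; exact: gam_between.
Qed.

Lemma gam0 x y : dist p x <= rho -> dist x y <= r -> gam x y 0 = x.
Proof.
move=> px xy; apply/esym/gam_unique => //; first by rewrite lexx ler01.
by split; rewrite ?mdistxx ?mul0r // subr0 mul1r.
Qed.

Lemma gam1 x y : dist p x <= rho -> dist x y <= r -> gam x y 1 = y.
Proof.
move=> px xy; apply/esym/gam_unique => //; first by rewrite lexx ler01.
by split; rewrite ?mdistxx ?mul1r // subrr mul0r.
Qed.

(** For [t <= s] the point of ratio [t / s] on the segment from [x] to [gam x y s] has ratio [t] on
    the whole segment, so by uniqueness it is [gam x y t]. *)
Lemma gam_dist x y s t : dist p x <= rho -> dist x y <= r ->
  0 <= s <= 1 -> 0 <= t <= 1 ->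
  dist (gam x y s) (gam x y t) = `|s - t| * dist x y.
Proof.
move=> px xy; wlog ts : s t / t <= s => [hw s01 t01|].
  have [ts|/ltW st] := leP t s; first exact: hw.
  by rewrite metric_sym distrC; exact: hw.
move=> s01 t01; have [h1 h2] := between_eq (gam_between px xy s01).
case/andP: (s01) => s0 s1; case/andP: (t01) => t0 t1.
have D0 := mdist_ge0 x y.
have xm : dist x (gam x y s) <= r by rewrite h1; apply: le_trans xy; nra.
have [sz|s_pos] : s = 0 \/ 0 < s.
  by move: s0; rewrite le_eqVlt => /orP[/eqP <-|]; [left|right].
  have -> : t = 0 by apply/eqP; rewrite eq_le t0 andbT; lra.
  by rewrite sz subrr normr0 mul0r mdistxx.
have ts01 : 0 <= t / s <= 1.
  by rewrite divr_ge0 //= ler_pdivrMr // mul1r.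
have [g1 g2] := between_eq (gam_between px xm ts01).
have tsE : t / s * s = t by rewrite divfK // gt_eqF.
rewrite h1 mulrA tsE in g1; rewrite h1 mulrA mulrBl mul1r tsE in g2.
have e : gam x (gam x y s) (t / s) = gam x y t.
  apply: gam_unique => //; split; first by rewrite g1.
  apply: le_trans (metric_triangle _ (gam x y s) _) _.
  by rewrite g2 h2; lra.
by rewrite metric_sym -e g2 ger0_norm //; lra.
Qed.

Lemma closed_le_fun {T : topologicalType} (f g : T -> R) :
  continuous f -> continuous g -> closed [set z | f z <= g z].
Proof.
move=> cf cg; have cfg : continuous (fun z => g z - f z).
  by move=> z; apply: cvgB; [exact: cg|exact: cf].
have := (continuous_closedP _).1 cfg _ (@closed_ge R 0).
by congr closed; apply/seteqP; split=> z /=; rewrite subr_ge0.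
Qed.

(** Uniform continuity from uniqueness: equal data cannot have points [e] apart, so on the compact
    set of pairs of data with points [e] apart the difference of the data has a positive minimum. *)
Lemma gam_near (e : R) : proper_space X -> 0 < e ->
  exists2 delta : R, 0 < delta & forall x x' y y' s s',
    dist p x <= rho -> dist p x' <= rho -> dist x y <= r -> dist x' y' <= r ->
    0 <= s <= 1 -> 0 <= s' <= 1 ->
    dist x x' < delta -> dist y y' < delta -> `|s - s'| < delta ->
    dist (gam x y s) (gam x' y' s') < e.
Proof.
move=> Xp e0.
pose W := (X * X * X * X * X * X * R * R)%type.
have [K [cK KP]] : exists K : set X, compact K /\
    forall x y s, dist p x <= rho -> dist x y <= r -> 0 <= s <= 1 ->
      [/\ K x, K y & K (gam x y s)].
  exists [set z | dist p z <= rho + r + r]; split; first exact: Xp.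
  move=> x y s px xy /andP[s0 s1].
  have [h1 _] := between_eq (gam_between px xy (introT andP (conj s0 s1))).
  have := metric_triangle p x y; have := metric_triangle p x (gam x y s).
  have := mdist_ge0 x y; rewrite /= h1.
  by split => /=; nra.
have c1 (U V : topologicalType) : continuous (@fst U V) by move=> z; exact: cvg_fst.
have c2 (U V : topologicalType) : continuous (@snd U V) by move=> z; exact: cvg_snd.
have cc (U V V' : topologicalType) (f : U -> V) (g : V -> V') :
    continuous f -> continuous g -> continuous (fun z => g (f z)).
  by move=> cf cg z; apply: (@continuous_comp _ _ _ f g); [exact: cf|exact: cg].
pose gs' (z : W) : R := z.2.          pose gs (z : W) : R := z.1.2.
pose gm' (z : W) : X := z.1.1.2.      pose gm (z : W) : X := z.1.1.1.2.
pose gy' (z : W) : X := z.1.1.1.1.2.  pose gy (z : W) : X := z.1.1.1.1.1.2.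
pose gx' (z : W) : X := z.1.1.1.1.1.1.2.
pose gx (z : W) : X := z.1.1.1.1.1.1.1.
have p1 : continuous (fun z : W => z.1) by exact: c1.
have p2 : continuous (fun z : W => z.1.1) := cc _ _ _ _ _ p1 (@c1 _ _).
have p3 : continuous (fun z : W => z.1.1.1) := cc _ _ _ _ _ p2 (@c1 _ _).
have p4 : continuous (fun z : W => z.1.1.1.1) := cc _ _ _ _ _ p3 (@c1 _ _).
have p5 : continuous (fun z : W => z.1.1.1.1.1) := cc _ _ _ _ _ p4 (@c1 _ _).
have p6 : continuous (fun z : W => z.1.1.1.1.1.1) := cc _ _ _ _ _ p5 (@c1 _ _).
have cgs' : continuous gs' by exact: c2.
have cgs : continuous gs := cc _ _ _ _ _ p1 (@c2 _ _).
have cgm' : continuous gm' := cc _ _ _ _ _ p2 (@c2 _ _).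
have cgm : continuous gm := cc _ _ _ _ _ p3 (@c2 _ _).
have cgy' : continuous gy' := cc _ _ _ _ _ p4 (@c2 _ _).
have cgy : continuous gy := cc _ _ _ _ _ p5 (@c2 _ _).
have cgx' : continuous gx' := cc _ _ _ _ _ p6 (@c2 _ _).
have cgx : continuous gx := cc _ _ _ _ _ p6 (@c1 _ _).
have cd (f g : W -> X) : continuous f -> continuous g ->
    continuous (fun z => dist (f z) (g z)).
  by move=> cf cg z; apply: cvg_dist; [exact: cf|exact: cg].
have cM (f g : W -> R) : continuous f -> continuous g ->
    continuous (fun z => f z * g z).
  by move=> cf cg z; apply: cvgM; [exact: cf|exact: cg].
have cB (f g : W -> R) : continuous f -> continuous g ->
    continuous (fun z => f z - g z).
  by move=> cf cg z; apply: cvgB; [exact: cf|exact: cg].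
have cD (f g : W -> R) : continuous f -> continuous g ->
    continuous (fun z => f z + g z).
  by move=> cf cg z; apply: cvgD; [exact: cf|exact: cg].
have ck (k : R) : continuous (fun _ : W => k) by move=> z; exact: cvg_cst.
have cbet (fx fy fm : W -> X) (fs : W -> R) :
    continuous fx -> continuous fy -> continuous fm -> continuous fs ->
    closed [set z | between (fs z) (fx z) (fy z) (fm z)].
  move=> cfx cfy cfm cfs.
  have := @closedI _ [set z | dist (fx z) (fm z) <= fs z * dist (fx z) (fy z)]
    [set z | dist (fm z) (fy z) <= (1 - fs z) * dist (fx z) (fy z)].
  apply; apply: closed_le_fun; try exact: cd.
    by apply: cM => //; exact: cd.
  by apply: (cM (fun z => 1 - fs z)); [exact: (cB (fun=> 1))|exact: cd].
pose I := `[0, 1]%classic : set R.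
have cI : compact I by exact: segment_compact.
pose box : set W := K `*` K `*` K `*` K `*` K `*` K `*` I `*` I.
have cbox : compact box by do 7 (apply: compact_setX => //).
(* The points [gm] and [gm'] are free coordinates tied to the data by the closed condition
   [between]; [gam], whose continuity is at stake, must not enter the definition of a closed set. *)
pose B : set W := box `&`
  ([set z | dist p (gx z) <= rho] `&` [set z | dist (gx z) (gy z) <= r] `&`
   [set z | between (gs z) (gx z) (gy z) (gm z)] `&`
   [set z | between (gs' z) (gx' z) (gy' z) (gm' z)] `&`
   [set z | e <= dist (gm z) (gm' z)]).
have cB' : compact B.
  rewrite /B; apply: compact_closedI => //.
  apply: closedI; first apply: closedI; first apply: closedI; first apply: closedI.
  - apply: closed_le_fun; last exact: ck.
    by apply: (cd (fun=> p) gx) => // z; exact: cvg_cst.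
  - by apply: closed_le_fun; [exact: cd|exact: ck].
  - exact: cbet.
  - exact: cbet.
  - by apply: closed_le_fun; [exact: ck|exact: cd].
pose f z := dist (gx z) (gx' z) + dist (gy z) (gy' z) + `|gs z - gs' z|.
have cf : continuous f.
  apply: (@cD (fun z => dist (gx z) (gx' z) + dist (gy z) (gy' z))).
    by apply: cD; exact: cd.
  move=> z; apply: cvg_norm; exact: (cB gs gs').
have inB x x' y y' s s' : dist p x <= rho -> dist p x' <= rho ->
    dist x y <= r -> dist x' y' <= r -> 0 <= s <= 1 -> 0 <= s' <= 1 ->
    e <= dist (gam x y s) (gam x' y' s') ->
    B (x, x', y, y', gam x y s, gam x' y' s', s, s').
  move=> px px' xy xy' s01 s01' ge.
  have [k1 k2 k3] := KP _ _ _ px xy s01; have [k4 k5 k6] := KP _ _ _ px' xy' s01'.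
  split.
    by split; [do 6 (split=> //)|]; rewrite /I /= in_itv.
  by split=> //; split; [split=> //; exact: gam_between|exact: gam_between].
have [B0|/set0P B0] := eqVneq B set0.
  exists 1 => // x x' y y' s s' px px' xy xy' s01 s01' _ _ _.
  rewrite ltNge; apply/negP => /(inB _ _ _ _ _ _ px px' xy xy' s01 s01').
  by rewrite B0.
have [k kB kmin] := compact_EVT_min B0 cB' (continuous_subspaceT cf).
have fk : 0 < f k.
  move: kB; rewrite inE => -[bk [[[[pk rk] b1] b2] ek]].
  rewrite lt_neqAle eq_sym; apply/andP; split; last first.
    by rewrite /f !addr_ge0 ?mdist_ge0.
  apply/eqP => f0.
  have d1 := mdist_ge0 (gx k) (gx' k); have d2 := mdist_ge0 (gy k) (gy' k).
  have d3 := normr_ge0 (gs k - gs' k).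
  have ex : gx k = gx' k by apply: dist_eq0; rewrite /f in f0; lra.
  have ey : gy k = gy' k by apply: dist_eq0; rewrite /f in f0; lra.
  have es : gs k = gs' k.
    apply/eqP; rewrite -subr_eq0 -normr_le0; rewrite /f in f0; lra.
  have s01 : 0 <= gs k <= 1 by case: bk => -[_ h] _; move: h; rewrite /I /= in_itv.
  have em : gm k = gm' k.
    rewrite (gam_unique pk rk s01 b1); apply/esym/gam_unique => //.
    by rewrite ex ey es.
  by move: ek => /=; rewrite em mdistxx leNgt e0.
(* [f] is a sum of three terms, each of them below a third of its minimum. *)
exists (f k / 3); first by lra.
move=> x x' y y' s s' px px' xy xy' s01 s01' h1 h2 h3.
rewrite ltNge; apply/negP => /(inB _ _ _ _ _ _ px px' xy xy' s01 s01') bB.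
by have := kmin _ (mem_set bB); rewrite /f /= -/f; rewrite /f in h1 h2 h3; lra.
Qed.

Lemma cvg_gam {T : Type} (F : set_system T) (FF : Filter F) (f g : T -> X)
    (k : T -> R) x y s : proper_space X ->
  f @ F --> x -> g @ F --> y -> k @ F --> s ->
  dist p x <= rho -> dist x y <= r -> 0 <= s <= 1 ->
  (\forall t \near F, [/\ dist p (f t) <= rho, dist (f t) (g t) <= r &
     0 <= k t <= 1]) ->
  gam (f t) (g t) (k t) @[t --> F] --> gam x y s.
Proof.
move=> Xp fx gy ks px xy s01 nF; apply: cvg_metricP => e e0.
have [d d0 dP] := gam_near Xp e0.
have n1 := cvg_metric_near FF fx d0; have n2 := cvg_metric_near FF gy d0.
have n3 : \forall t \near F, `|s - k t| < d by move/cvgrPdist_lt : ks; apply.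
near=> t; have [h1 h2 h3] : [/\ dist p (f t) <= rho, dist (f t) (g t) <= r &
  0 <= k t <= 1] by near: t.
by apply: dP => //; near: t.
Unshelve. all: by end_near. Qed.

End Good.
End Segments.

(** * Broken geodesics *)

Section Broken.
Context {R : realType} {X : metricType R}.
Implicit Types (s t u : R) (x y : nat -> X) (rho r h : R) (c : R -> X).

Definition broken (N : nat) x t : X :=
  let i := Num.truncn (N%:R * t) in gam (x i) (x i.+1) (N%:R * t - i%:R).

(** Infinite sequences that stay at [q] from [N] on: every node has a successor, [broken] makes
    sense at [t = 1], and Tychonoff's theorem applies to the product. *)
Definition tuples (p q : X) (N : nat) h : set (nat -> X) :=
  [set x | [/\ x 0%N = p, forall i, (N <= i)%N -> x i = q &
    forall i, dist (x i) (x i.+1) <= h]].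

Definition edge x i := dist (x i) (x i.+1).

(* Not constant speed on all of [0, 1]: distances are those of a segment only at
   scale delta. *)
Definition local_geodesic (l : R) c := exists2 delta : R, 0 < delta &
  forall s t, 0 <= s -> s <= t -> t <= 1 -> t <= s + delta ->
    dist (c s) (c t) = l * (t - s).

Definition critical (N : nat) x := forall i, (i.+1 < N)%N ->
  x i.+1 = gam (x i) (x i.+2) (1 / 2).

Section Tuples.
Context (p q : X) (rho r h : R) (N : nat).
Context (good : segments_on p rho r) (h0 : 0 <= h) (N1 : (1 < N)%N)
  (hrho : N.+1%:R * h <= rho) (hr : 4 * h <= r).
Local Notation T := (tuples p q N h).

Let N_gt0 : 0 < N%:R :> R.
Proof. by rewrite ltr0n; case: (N) N1. Qed.

Lemma tuple_edge x i : T x -> dist (x i) (x i.+1) <= h.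
Proof. by case. Qed.

Lemma tuple_le x i : T x -> dist p (x i) <= N%:R * h.
Proof.
move=> [x0 xN xh].
have le j : dist p (x j) <= j%:R * h.
  elim: j => [|j IH]; first by rewrite x0 mdistxx mul0r.
  have := metric_triangle p (x j) (x j.+1); have := xh j.
  by rewrite -natr1 mulrDl; lra.
have [iN|/ltnW Ni] := leqP i N.
  by apply: le_trans (le i) _; rewrite ler_wpM2r // ler_nat.
by rewrite (xN i) // -(xN N) //; exact: le.
Qed.

Lemma tuple_region x i : T x -> dist p (x i) <= rho.
Proof.
move=> Tx; apply: le_trans (tuple_le i Tx) (le_trans _ hrho).
by rewrite ler_wpM2r // ler_nat.
Qed.

Lemma tuple_r x i : T x -> dist (x i) (x i.+1) <= r.
Proof. by move=> Tx; have := tuple_edge i Tx; move: h0 hr; lra. Qed.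

Lemma tuple_r2 x i : T x -> dist (x i) (x i.+2) <= r.
Proof.
move=> Tx; have := metric_triangle (x i) (x i.+1) (x i.+2).
by have := tuple_edge i Tx; have := tuple_edge i.+1 Tx; move: h0 hr; lra.
Qed.

(** [Num.truncn] jumps at the right end of the piece, but there both formulas give [x i.+1]; so
    closed pieces are allowed. *)
Lemma broken_piece x i t : T x -> i%:R <= N%:R * t -> N%:R * t <= i.+1%:R ->
  broken N x t = gam (x i) (x i.+1) (N%:R * t - i%:R).
Proof.
move=> Tx it ti; rewrite /broken.
have [ti'|ti'] := ltP (N%:R * t) i.+1%:R.
  have -> // : Num.truncn (N%:R * t) = i.
  by apply/truncn_def; rewrite it ti'.
have tE : N%:R * t = i.+1%:R by apply/eqP; rewrite eq_le ti.
rewrite tE natrK subrr -natrB // subSnn (gam0 good) ?(gam1 good) //.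
- exact: tuple_region.
- exact: tuple_r.
- exact: tuple_region.
- exact: tuple_r.
Qed.

Lemma broken_node x i : T x -> broken N x (i%:R / N%:R) = x i.
Proof.
move=> Tx; have e : N%:R * (i%:R / N%:R) = i%:R :> R.
  by rewrite mulrC divfK // gt_eqF.
rewrite (@broken_piece x i) // ?e ?ler_nat // subrr (gam0 good) //.
- exact: tuple_region.
- exact: tuple_r.
Qed.

Lemma broken_dist x i s t : T x -> i%:R <= N%:R * s -> s <= t ->
  N%:R * t <= i.+1%:R ->
  dist (broken N x s) (broken N x t) = N%:R * edge x i * (t - s).
Proof.
move=> Tx is_ st ti.
have Nst : N%:R * s <= N%:R * t by rewrite ler_pM2l.
rewrite -natr1 in ti.
rewrite !(@broken_piece x i) // ?(gam_dist good) -?natr1 //; try lra.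
- by rewrite distrC ger0_norm /edge; [ring|lra].
- exact: tuple_region.
- exact: tuple_r.
Qed.

Lemma piece_index t : 0 <= t -> t <= 1 ->
  exists2 i, (i < N)%N & i%:R <= N%:R * t <= i.+1%:R.
Proof.
move=> t0 t1; have Nt0 : 0 <= N%:R * t by rewrite mulr_ge0 // ltW.
have /andP[i1 i2] := truncn_itv Nt0; have [iN|Ni] := ltnP (Num.truncn (N%:R * t)) N.
  by exists (Num.truncn (N%:R * t)) => //; rewrite i1 ltW.
exists N.-1; first by case: (N) N1.
have -> : N.-1.+1 = N by case: (N) N1.
apply/andP; split; last by rewrite ler_piMr // ltW.
by apply: le_trans i1; rewrite ler_nat (leq_trans (leq_pred _)).
Qed.

Lemma chain_unit (Q : R -> R -> Prop) :
  (forall s t u, s <= t -> t <= u -> Q s t -> Q t u -> Q s u) ->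
  (forall i s t, (i < N)%N -> i%:R <= N%:R * s -> s <= t ->
     N%:R * t <= i.+1%:R -> Q s t) ->
  forall s t, 0 <= s -> s <= t -> t <= 1 -> Q s t.
Proof.
move=> Qtr Qi s t s0 st t1.
have tau0 : 0%:R / N%:R = 0 :> R by rewrite mul0r.
have tau1 : N%:R / N%:R = 1 :> R by rewrite divff // gt_eqF.
have := @chain_pieces R Q (fun i => i%:R / N%:R) N Qtr.
rewrite tau0 tau1; apply => //.
- move=> u u0 u1; have [i iN /andP[i1 i2]] := piece_index u0 u1.
  exact: Qi iN i1 (lexx u) i2.
- by move=> i _; rewrite ler_pM2r ?invr_gt0 // ler_nat.
- move=> i u v iN iu uv vi; apply: (Qi i) => //.
    by rewrite mulrC -ler_pdivrMr.
  by rewrite mulrC -ler_pdivlMr.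
Qed.

Lemma broken_lipschitz x s t : T x -> 0 <= s -> s <= t -> t <= 1 ->
  dist (broken N x s) (broken N x t) <= N%:R * h * (t - s).
Proof.
move=> Tx; move: s t.
apply: (@chain_unit (fun s t => dist (broken N x s) (broken N x t) <= N%:R * h * (t - s))).
  move=> s t u st tu h1 h2.
  by have := metric_triangle (broken N x s) (broken N x t) (broken N x u); lra.
move=> i s t iN is_ st ti; rewrite (@broken_dist x i) //.
by rewrite ler_wpM2r ?subr_ge0 // ler_pM2l //; exact: tuple_edge.
Qed.

Lemma broken_near_node x i t : T x -> i%:R <= N%:R * t ->
  N%:R * t <= i.+1%:R -> dist (x i) (broken N x t) <= h.
Proof.
move=> Tx it ti; rewrite -{1}(broken_node i Tx).
have e : N%:R * (i%:R / N%:R) = i%:R :> R.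
  by rewrite mulrC divfK // gt_eqF.
have le : i%:R / N%:R <= t by rewrite ler_pdivrMr // mulrC.
rewrite (@broken_dist x i) // ?e //.
have -> : N%:R * edge x i * (t - i%:R / N%:R) = edge x i * (N%:R * t - i%:R).
  by rewrite mulrBr -{2}e; ring.
rewrite -natr1 in ti; have := tuple_edge i Tx; rewrite -/(edge x i).
have : 0 <= edge x i by exact: mdist_ge0.
by nra.
Qed.

(** Nodes are within [N * h] of [p] and a piece strays at most [h] from its first node; this
    explains [N.+1] in [hrho]. *)
Lemma broken_region x t : T x -> 0 <= t -> t <= 1 ->
  dist p (broken N x t) <= rho.
Proof.
move=> Tx t0 t1; have [i iN /andP[it ti]] := piece_index t0 t1.
have := metric_triangle p (x i) (broken N x t).
have := broken_near_node Tx it ti; have := tuple_le i Tx.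
by move: hrho; rewrite -natr1 mulrDl mul1r; lra.
Qed.

Lemma broken0 x : T x -> broken N x 0 = p.
Proof.
by move=> Tx; have := broken_node 0 Tx; rewrite mul0r => ->; case: Tx.
Qed.

Lemma broken1 x : T x -> broken N x 1 = q.
Proof.
move=> Tx; have := broken_node N Tx; rewrite divff ?gt_eqF // => ->.
by case: Tx => _ -> //.
Qed.

Lemma lipschitz_continuous a b c (k : R) :
  (forall s t, a <= s -> s <= t -> t <= b -> dist (c s) (c t) <= k * (t - s)) ->
  {within `[a, b], continuous c}.
Proof.
move=> ck; apply/subspace_continuousP => t tab; apply: cvg_metricP => e e0.
pose k' := `|k| + 1.
have k'0 : 0 < k' by rewrite /k' ltr_wpDl.
have kk' : k <= k' by rewrite /k'; have := ler_norm k; lra.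
rewrite near_withinE; near=> s => sab.
have st : `|t - s| < e / k'.
  by near: s; apply: cvgr_dist_lt; [exact: cvg_id|rewrite divr_gt0].
have st' : k' * `|t - s| < e by rewrite mulrC -ltr_pdivlMr.
have dst : dist (c t) (c s) <= k * `|t - s|.
  move: tab sab; rewrite /= !in_itv /= => /andP[t1 t2] /andP[s1 s2].
  have [ts|/ltW ts] := leP t s.
    by rewrite distrC ger0_norm ?subr_ge0 //; exact: ck.
  by rewrite ger0_norm ?subr_ge0 // metric_sym; exact: ck.
have := normr_ge0 (t - s).
by nra.
Unshelve. all: by end_near. Qed.

Lemma broken_curve x : T x -> curve_between 0 1 (broken N x) p q.
Proof.
move=> Tx; split; [split; first exact: ltr01|exact: broken0|exact: broken1].
by apply: (@lipschitz_continuous _ _ _ (N%:R * h)) => s t; exact: broken_lipschitz.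
Qed.

Lemma broken_length_le x : T x ->
  (curve_length 0 1 (broken N x) <= (\sum_(k < N) edge x k)%:E)%E.
Proof.
move=> Tx.
(* Total edge length traversed up to [t]; on piece [i] only the summand of index [i] varies. *)
pose A t := \sum_(k < N) edge x k * clamp 0 1 (N%:R * t - k%:R).
have A0 : A 0 = 0.
  apply: big1 => k _; rewrite clamp_l ?mulr0 //.
have A1 : A 1 = \sum_(k < N) edge x k.
  apply: eq_bigr => k _; rewrite mulr1 clamp_r ?mulr1 //.
  by rewrite lerBrDr addrC natr1 ler_nat.
rewrite -A1 -[A 1]subr0 -{2}A0; apply: curve_length_le.
apply: (@chain_unit (fun s t => dist (broken N x s) (broken N x t) <= A t - A s)).
  move=> s t u st tu h1 h2.
  by have := metric_triangle (broken N x s) (broken N x t) (broken N x u); lra.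
move=> i s t iN is_ st ti; rewrite (@broken_dist x i) //.
have Nst : N%:R * s <= N%:R * t by rewrite ler_pM2l.
rewrite /A -sumrB (bigD1 (Ordinal iN)) //= big1 => [|k ki].
  rewrite addr0 -mulrBr !clamp_id; rewrite -?natr1 in ti *; try lra.
rewrite -mulrBr; apply/eqP; rewrite mulf_eq0; apply/orP; right.
rewrite subr_eq0; apply/eqP.
have [ki'|ki'|ki'] := ltngtP k i.
- have : k.+1%:R <= i%:R :> R by rewrite ler_nat.
  by rewrite -natr1 => ?; rewrite !clamp_r //; lra.
- have : i.+1%:R <= k%:R :> R by rewrite ler_nat.
  by move=> ?; rewrite !clamp_l //; lra.
- by move: ki; rewrite -val_eqE /= ki' eqxx.
Qed.

Lemma critical_edge x i : T x -> critical N x -> (i < N)%N ->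
  edge x i = edge x 0.
Proof.
move=> Tx cx; elim: i => [//|i IH] iN; rewrite -(IH (ltnW iN)).
have m01 : 0 <= (1 / 2 : R) <= 1 by apply/andP; split; lra.
have := gam_between good (tuple_region i Tx) (tuple_r2 i Tx) m01.
rewrite -cx // => /between_eq [e1 e2].
by rewrite /edge e1 e2; lra.
Qed.

(** Since [x i.+1] is the midpoint, two consecutive edges run along the unique segment from [x i] to
    [x i.+2]. *)
Lemma critical_piece2 x i t : T x -> critical N x -> (i.+1 < N)%N ->
  i%:R <= N%:R * t -> N%:R * t <= i.+2%:R ->
  broken N x t = gam (x i) (x i.+2) ((N%:R * t - i%:R) / 2).
Proof.
move=> Tx cx iN it ti.
have m01 : 0 <= (1 / 2 : R) <= 1 by apply/andP; split; lra.
have := gam_between good (tuple_region i Tx) (tuple_r2 i Tx) m01.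
rewrite -cx // => /between_eq [e1 e2].
rewrite -!natr1 in ti.
apply: (gam_unique good); [exact: tuple_region|exact: tuple_r2| |].
  by apply/andP; split; lra.
have [ti'|ti'] := leP (N%:R * t) i.+1%:R.
- rewrite (@broken_piece x i) //.
  rewrite -natr1 in ti'.
  have t01 : 0 <= N%:R * t - i%:R <= 1 by apply/andP; split; lra.
  have [g1 g2] := between_eq (gam_between good (tuple_region i Tx) (tuple_r i Tx) t01).
  split; first by rewrite g1 e1; lra.
  apply: le_trans (metric_triangle _ (x i.+1) _) _.
  by rewrite g2 e1 e2; lra.
- have iE : i.+1%:R = i%:R + 1 :> R by rewrite natr1.
  rewrite (@broken_piece x i.+1) // ?iE; try lra.
  rewrite -natr1 in ti'.
  have t01 : 0 <= N%:R * t - (i%:R + 1) <= 1 by apply/andP; split; lra.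
  have [g1 g2] := between_eq (gam_between good (tuple_region i.+1 Tx) (tuple_r i.+1 Tx) t01).
  split; last by rewrite g2 e2; lra.
  apply: le_trans (metric_triangle _ (x i.+1) _) _.
  by rewrite g1 e1 e2; lra.
Qed.

(** A parameter interval of length at most [1 / N] lies in two consecutive pieces, and these form a
    single segment. *)
Lemma critical_local_geodesic x : T x -> critical N x ->
  local_geodesic (N%:R * edge x 0) (broken N x).
Proof.
move=> Tx cx; exists N%:R^-1; first by rewrite invr_gt0.
move=> s t s0 st t1 ts.
have Nst : N%:R * s <= N%:R * t by rewrite ler_pM2l.
have Nts : N%:R * t <= N%:R * s + 1.
  have : N%:R * t <= N%:R * (s + N%:R^-1) by rewrite ler_pM2l.
  by rewrite mulrDr divff // gt_eqF.
have Nt1 : N%:R * t <= N%:R by rewrite ler_piMr // ltW.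
have [i iN /andP[i1 i2]] : exists2 i, (i.+1 < N)%N &
    (i%:R <= N%:R * s) && (N%:R * t <= i.+2%:R).
  have [|i iN /andP[i1 i2]] := piece_index s0; first by lra.
  have [iN'|iN'] := ltnP i.+1 N.
    by exists i; rewrite ?i1 // -natr1; lra.
  (* For [s] in the last piece the pair of pieces is moved back by one. *)
  have iE : i.+1 = N by apply/eqP; rewrite eqn_leq iN.
  exists N.-2; first by case: (N) N1 => [|[]].
  have -> : N.-2.+2 = N by case: (N) N1 => [|[]].
  rewrite Nt1 andbT; apply: le_trans i1; rewrite ler_nat -iE.
  exact: leq_pred.
rewrite -!natr1 in i2.
rewrite !(@critical_piece2 x i) // -?[i.+2%:R]natr1 -?[i.+1%:R]natr1; try lra.
have m01 : 0 <= (1 / 2 : R) <= 1 by apply/andP; split; lra.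
have := gam_between good (tuple_region i Tx) (tuple_r2 i Tx) m01.
rewrite -cx // => /between_eq [e1 e2].
have ei : edge x i = edge x 0 by apply: critical_edge => //; exact: ltnW.
rewrite (gam_dist good); last 2 first.
- by apply/andP; split; lra.
- by apply/andP; split; lra.
- rewrite distrC ger0_norm; last by lra.
  by rewrite -ei /edge e1; lra.
- exact: tuple_region.
- exact: tuple_r2.
Qed.

End Tuples.
End Broken.

(** * Energy and the midpoint relaxation of tuples *)

Section Relaxation.
Context {R : realType} {X : metricType R}.
Local Notation seqX := {ptws nat -> X}.
Implicit Types (x y : nat -> X) (rho r h : R).

Lemma continuous_coord i : continuous (fun x : seqX => x i).
Proof. exact: (@proj_continuous nat (fun=> X) i). Qed.

Lemma cvg_coords {T : Type} (F : set_system T) (FF : Filter F)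
    (f : T -> seqX) (x : seqX) :
  (forall i, f t i @[t --> F] --> x i) -> f @ F --> x.
Proof.
move=> fx; apply/cvg_sup => i U /=.
have /= -> := @nbhsE (initial_topology (fun y : seqX => y i)) x.
move=> -[B [[C oC <-] /= Cx] BU].
apply: (@filterS _ _ _ [set t | C (f t i)]); first by move=> t /= Ct; exact: BU.
by apply: fx; exact: open_nbhs_nbhs.
Qed.

(** Indexed by the left neighbour of the moved node, so that [i.+1 < N] says that an inner node
    moves. *)
Definition relax x i : nat -> X :=
  fun j => if j == i.+1 then gam (x i) (x i.+2) (1 / 2) else x j.

(** The inner nodes move one after another, not simultaneously: each move then does not raise the
    energy of the current tuple. *)
Definition relax_all (N : nat) x : nat -> X :=
  foldr (fun i y => relax y i) x (iota 0 N.-1).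

Definition energy (N : nat) x : R := \sum_(k < N) edge x k ^+ 2.

Lemma continuous_sum {T : topologicalType} (N : nat) (f : 'I_N -> T -> R) :
  (forall k, continuous (f k)) -> continuous (fun u => \sum_(k < N) f k u).
Proof.
elim: N f => [|N IH] f cf.
  rewrite (_ : (fun u => _) = (fun=> 0)); first by move=> u; exact: cvg_cst.
  by apply/funext => u; rewrite big_ord0.
rewrite (_ : (fun u => _) =
  (fun u => f ord0 u + \sum_(k < N) f (lift ord0 k) u)); last first.
  by apply/funext => u; rewrite big_ord_recl.
by move=> u; apply: cvgD; [exact: cf|apply: IH => k; exact: cf].
Qed.

Lemma continuous_dist_coord i j : continuous (fun x : seqX => dist (x i) (x j)).
Proof.
move=> x; exact: cvg_dist (@continuous_coord i x) (@continuous_coord j x).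
Qed.

Lemma continuous_energy N : continuous (energy N : seqX -> R).
Proof.
apply: continuous_sum => k.
rewrite (_ : (fun u => _) =   (fun u : seqX => dist (u k) (u k.+1) * dist (u k) (u k.+1))); last first.
  by apply/funext => u; rewrite expr2.
move=> u; exact: cvgM (@continuous_dist_coord k k.+1 u) (@continuous_dist_coord k k.+1 u).
Qed.

Lemma compact_tuples p q N h : proper_space X -> 0 <= h ->
  compact (tuples p q N h : set seqX).
Proof.
move=> Xp h0.
have -> : tuples p q N h = [set x : seqX | forall i, dist p (x i) <= N%:R * h]
    `&` tuples p q N h.
  by apply/seteqP; split=> [x Tx|x []] //; split=> // i; exact: tuple_le Tx.
apply: compact_closedI.
  exact: (@tychonoff nat (fun=> X) (fun=> [set y | dist p y <= N%:R * h])).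
have -> : tuples p q N h = [set x : seqX | dist (x 0%N) p <= 0] `&`
    \bigcap_(i in [set i | (N <= i)%N]) [set x : seqX | dist (x i) q <= 0] `&`
    \bigcap_i [set x : seqX | dist (x i) (x i.+1) <= h].
  apply/seteqP; split=> x.
    move=> [x0 xN xh]; split; first split.
    - by rewrite /= x0 mdistxx.
    - by move=> i /= Ni; rewrite xN // mdistxx.
    - by move=> i _; exact: xh.
  move=> [[x0 xN] xh]; split.
  - exact: dist_eq0.
  - by move=> i Ni; apply: dist_eq0; exact: xN.
  - by move=> i; exact: xh.
have cc (c : R) : continuous (fun _ : seqX => c) by exact: cst_continuous.
have cp (y : X) i : continuous (fun x : seqX => dist (x i) y).
  by move=> x; exact: cvg_dist (@continuous_coord i x) (@cst_continuous seqX X y x).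
apply: closedI; first apply: closedI.
- exact: closed_le_fun.
- by apply: closed_bigI => i _; exact: closed_le_fun.
- apply: closed_bigI => i _; apply: closed_le_fun => //.
  exact: continuous_dist_coord.
Qed.

Section Tuples.
Context (p q : X) (rho r h : R) (N : nat).
Context (good : segments_on p rho r) (h0 : 0 <= h) (N1 : (1 < N)%N)
  (hrho : N.+1%:R * h <= rho) (hr : 4 * h <= r).
Local Notation T := (tuples p q N h).

Let half01 : 0 <= (1 / 2 : R) <= 1.
Proof. by apply/andP; split; lra. Qed.

Lemma midpoint_edge x i (m := gam (x i) (x i.+2) (1 / 2)) : T x ->
  dist (x i) m = dist (x i) (x i.+2) / 2 /\
  dist m (x i.+2) = dist (x i) (x i.+2) / 2.
Proof.
move=> Tx; have := gam_between good (tuple_region h0 hrho i Tx)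
  (tuple_r2 h0 hr i Tx) half01.
by move=> /between_eq[-> ->]; split; lra.
Qed.

Lemma relax_edge x i j : T x -> edge (relax x i) j =
  if (j == i) || (j == i.+1) then dist (x i) (x i.+2) / 2 else edge x j.
Proof.
move=> Tx; have [e1 e2] := midpoint_edge i Tx.
rewrite /edge /relax eqSS; have [->|ji] /= := eqVneq j i.
  by rewrite ltn_eqF.
by have [->|//] := eqVneq j i.+1.
Qed.

(** Both new edges are half of [dist (x i) (x i.+2)], hence at most the mean of the two old ones. *)
Lemma relax_tuple x i : T x -> (i.+1 < N)%N -> T (relax x i).
Proof.
move=> Tx iN; split.
- by rewrite /relax /=; case: Tx.
- move=> j Nj; rewrite /relax gtn_eqF; first by case: Tx => _ + _; apply.
  exact: leq_trans iN Nj.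
- move=> j; rewrite -/(edge (relax x i) j) relax_edge //.
  have := metric_triangle (x i) (x i.+1) (x i.+2).
  have := tuple_edge i Tx; have := tuple_edge i.+1 Tx; have := tuple_edge j Tx.
  by rewrite /edge; case: ifP => _; lra.
Qed.

Lemma energy_relaxD x i : T x -> (i.+1 < N)%N ->
  energy N x - energy N (relax x i) =
  edge x i ^+ 2 + edge x i.+1 ^+ 2 - dist (x i) (x i.+2) ^+ 2 / 2.
Proof.
move=> Tx iN; rewrite /energy -sumrB.
rewrite (bigD1 (Ordinal (ltnW iN))) //= (bigD1 (Ordinal iN)) /=; last first.
  by rewrite -val_eqE /= gtn_eqF.
rewrite big1 => [|k /andP[k1 k2]]; last first.
  rewrite -val_eqE /= in k1; rewrite -val_eqE /= in k2.
  by rewrite relax_edge // (negbTE k1) (negbTE k2) subrr.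
by rewrite !relax_edge // !eqxx orbT /=; field.
Qed.

(** With old edges a, b and D = [dist (x i) (x i.+2)], the drop a^2 + b^2 - D^2/2 equals (a - b)^2/2
    + (a + b - D)(a + b + D)/2. Both terms are nonnegative, and they vanish only if a = b and a + b
    = D, that is, if the node already is the midpoint. *)
Lemma energy_relax x i : T x -> (i.+1 < N)%N ->
  energy N (relax x i) <= energy N x /\
  (energy N (relax x i) = energy N x -> relax x i = x).
Proof.
move=> Tx iN; have := energy_relaxD Tx iN.
set D := dist _ _ => eD.
have D0 : 0 <= D by exact: mdist_ge0.
have tri : D <= edge x i + edge x i.+1 by exact: metric_triangle.
have e0 : 0 <= edge x i by exact: mdist_ge0.
have e1 : 0 <= edge x i.+1 by exact: mdist_ge0.
have sq : edge x i ^+ 2 + edge x i.+1 ^+ 2 - D ^+ 2 / 2 =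
    (edge x i - edge x i.+1) ^+ 2 / 2 +
    (edge x i + edge x i.+1 - D) * (edge x i + edge x i.+1 + D) / 2 by field.
have s1 : 0 <= (edge x i - edge x i.+1) ^+ 2 by exact: sqr_ge0.
have s2 : 0 <= (edge x i + edge x i.+1 - D) * (edge x i + edge x i.+1 + D).
  by apply: mulr_ge0; lra.
split; first lra.
move=> ee; have z1 : (edge x i - edge x i.+1) ^+ 2 = 0.
  by apply/eqP; rewrite eq_le s1 andbT; lra.
have z2 : (edge x i + edge x i.+1 - D) * (edge x i + edge x i.+1 + D) = 0.
  by apply/eqP; rewrite eq_le s2 andbT; lra.
have e01 : edge x i = edge x i.+1.
  by apply/eqP; rewrite -subr_eq0 -sqrf_eq0 z1.
have DE : D = edge x i + edge x i.+1.
  move/eqP: z2; rewrite mulf_eq0 => /orP[/eqP|/eqP]; lra.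
apply/funext => j; rewrite /relax; case: eqP => // ->.
apply/esym/(gam_unique good) => //.
- exact: tuple_region Tx.
- exact: tuple_r2 Tx.
- by split; rewrite -/D -/(edge x i) -/(edge x i.+1) DE; lra.
Qed.

(** If a whole sweep keeps the energy, so does each of its moves; each move is then trivial, so all
    of them acted on [x] itself. *)
Lemma relax_all_spec x : T x ->
  [/\ T (relax_all N x), energy N (relax_all N x) <= energy N x,
     energy N (relax_all N x) = energy N x -> critical N x &
     critical N x -> relax_all N x = x].
Proof.
move=> Tx; rewrite /relax_all.
have sN : all (fun i => (i.+1 < N)%N) (iota 0 N.-1).
  by apply/allP => i; rewrite mem_iota /= add0n ltn_predRL.
have sub : (critical N x -> forall i, i \in iota 0 N.-1 -> relax x i = x).
  move=> cx i; rewrite mem_iota add0n ltn_predRL => iN.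
  by apply/funext => j; rewrite /relax; case: eqP => // ->; rewrite -cx.
have [h1 h2 h3 h4] : let y := foldr (fun i y => relax y i) x (iota 0 N.-1) in
  [/\ T y, energy N y <= energy N x,
     energy N y = energy N x -> forall i, i \in iota 0 N.-1 -> relax x i = x &
     (forall i, i \in iota 0 N.-1 -> relax x i = x) -> y = x].
  elim: (iota 0 N.-1) sN {sub} => [|i s IH] /=; first by split.
  move=> /andP[iN /IH[Ty yE ycrit yfix]].
  set y := foldr _ _ _ in Ty yE ycrit yfix *.
  have [rE rfix] := energy_relax Ty iN.
  split; [exact: relax_tuple|exact: le_trans yE| |].
    move=> ee; have ye : energy N y = energy N x.
      by apply/eqP; rewrite eq_le yE -ee rE.
    have fx := ycrit ye; have yx := yfix fx.
    move=> j; rewrite inE => /orP[/eqP ->|]; last exact: fx.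
    by rewrite -yx; apply: rfix; rewrite ee.
  move=> fx; rewrite yfix => [|j js]; first by apply: fx; rewrite inE eqxx.
  by apply: fx; rewrite inE js orbT.
split=> //; last by move=> /sub; exact: h4.
move=> /h3 fx i iN; have := fx i; rewrite mem_iota add0n ltn_predRL => /(_ iN).
by move=> /(congr1 (@^~ i.+1)); rewrite /relax eqxx.
Qed.

Lemma continuous_relax i : proper_space X -> (i.+1 < N)%N ->
  {within (T : set seqX), continuous (relax^~ i : seqX -> seqX)}.
Proof.
move=> Xp iN; apply/subspace_continuousP => x Tx.
apply: cvg_coords => j.
have cj k : (y k : X) @[y --> within (T : set seqX) (nbhs x)] --> (x k : X).
  by apply: cvg_within_filter; exact: continuous_coord.
rewrite /from_subspace /relax /=; case: (j =P i.+1) => [_|//].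
apply: (@cvg_gam R X p rho r good seqX (within (T : set seqX) (nbhs x)) _
  (fun y => y i) (fun y => y i.+2) (fun=> 1 / 2) (x i) (x i.+2) (1 / 2) Xp
  (cj i) (cj i.+2)) => //.
- exact: cvg_cst.
- exact: tuple_region Tx.
- exact: tuple_r2 Tx.
- rewrite near_withinE; apply: nearW => y Ty; split=> //.
    exact: tuple_region Ty.
  exact: tuple_r2 Ty.
Qed.

Lemma continuous_relax_all : proper_space X ->
  {within (T : set seqX), continuous (relax_all N : seqX -> seqX)}.
Proof.
move=> Xp; rewrite /relax_all.
have sN : all (fun i => (i.+1 < N)%N) (iota 0 N.-1).
  by apply/allP => i; rewrite mem_iota /= add0n ltn_predRL.
elim: (iota 0 N.-1) sN => [|i s IH] /=.
  by move=> _; apply: continuous_subspaceT => x; exact: cvg_id.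
move=> /andP[iN sN]; have cs := IH sN.
have Ts x : T x -> T (foldr (fun i y => relax y i) x s).
  move=> Tx; elim: s sN {IH cs} => //= j s IH /andP[jN sN].
  by apply: relax_tuple => //; exact: IH.
apply/subspace_continuousP => x Tx.
have /subspace_continuousP/(_ _ Tx) cx := cs.
have /subspace_continuousP/(_ _ (Ts _ Tx)) cr := continuous_relax Xp iN.
apply: (cvg_trans _ cr) => W /= nW.
have := cx _ nW; rewrite /= !nbhs_simpl /within /= => hW.
by apply: filterS hW => u hu Tu; apply: hu => //; exact: Ts.
Qed.

End Tuples.
End Relaxation.

(** * Local geodesics of constant speed *)

Section LocalGeodesics.
Context {R : realType} {X : metricType R}.
Implicit Types (s t l : R) (c : R -> X).

Lemma local_geodesic_lipschitz l c s t : local_geodesic l c ->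
  0 <= s -> s <= t -> t <= 1 -> dist (c s) (c t) <= l * (t - s).
Proof.
move=> [d d0 cd]; move: s t.
apply: (@chain_local _ (fun s t => dist (c s) (c t) <= l * (t - s)) 0 1 d d0).
  by move=> s t u st tu h1 h2; have := metric_triangle (c s) (c t) (c u); lra.
by move=> s t s0 st t1 ts; rewrite cd.
Qed.

Lemma local_geodesic_ge0 l c : local_geodesic l c -> 0 <= l.
Proof.
move=> cl; have := local_geodesic_lipschitz cl (lexx 0) ler01 (lexx 1).
by rewrite subr0 mulr1; apply: le_trans; exact: mdist_ge0.
Qed.

Lemma local_geodesic_curve l c : local_geodesic l c -> curve 0 1 c.
Proof.
move=> cl; split; first exact: ltr01.
apply: (@lipschitz_continuous _ _ _ _ _ l) => s t.
exact: local_geodesic_lipschitz.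
Qed.

Lemma local_geodesic_segment l c : local_geodesic l c -> geodesic_segment 0 1 c.
Proof.
move=> cl; have [_ cc] := local_geodesic_curve cl.
have l0 := local_geodesic_ge0 cl.
have [d d0 cd] := cl; split; first by split => //; exact: ltr01.
- move=> s t s0 st t1 cst.
  (* A pause forces speed 0, and then the whole curve is constant. *)
  have lz : l = 0.
    pose u := Order.min t (s + d).
    have su : s < u by rewrite /u lt_min st ltrDl.
    have ut : u <= t by rewrite /u ge_min lexx.
    have ud : u <= s + d by rewrite /u ge_min lexx orbT.
    have := cd s u s0 (ltW su) (le_trans ut t1) ud.
    rewrite cst ?mdistxx; last by rewrite in_itv /= (ltW su).
    move=> /esym/eqP; rewrite mulf_eq0 => /orP[/eqP //|/eqP]; lra.
  move=> u; rewrite in_itv /= => /andP[u0 u1]; apply/esym/dist_eq0.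
  by have := local_geodesic_lipschitz cl (lexx 0) u0 u1; rewrite lz mul0r.
- move=> t0; rewrite in_itv /= => /andP[t00 t01].
  (* A window of width at most [d] around [t0], on which distances are exact. *)
  pose s := Order.max 0 (t0 - d / 2); pose t := Order.min 1 (t0 + d / 2).
  have s0 : 0 <= s by rewrite /s le_max lexx.
  have t1 : t <= 1 by rewrite /t ge_min lexx.
  have sd : t0 - d / 2 <= s by rewrite /s le_max lexx orbT.
  have td : t <= t0 + d / 2 by rewrite /t ge_min lexx orbT.
  have st : s < t.
    by rewrite /s /t gt_max !lt_min ltr01 /=; repeat (apply/andP; split); lra.
  exists s, t; split => //.
    rewrite /within /=; near=> u; rewrite /= !in_itv /= => /andP[u0 u1].
    have : `|t0 - u| < d / 2.
      by near: u; apply: cvgr_dist_lt; [exact: cvg_id|lra].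
    rewrite ltr_norml => /andP[h1 h2].
    rewrite /s /t ge_max le_min; repeat (apply/andP; split) => //; lra.
  apply: (@arclength_shortest_path _ _ _ _ _ (fun u => l * u)).
    split=> //; apply: continuous_subspaceW cc => u /=.
    by rewrite !in_itv /= => /andP[u1 u2]; apply/andP; split; lra.
  by move=> u v su uv vt; rewrite cd ?mulrBr //; lra.
Unshelve. all: by end_near. Qed.

(** Sampling with a step [1 / n] of at most [d] gives [n] chords of length [l / n] each. *)
Lemma local_geodesic_length l c : local_geodesic l c ->
  (l%:E <= curve_length 0 1 c)%E.
Proof.
move=> [d d0 cd].
have [n /ltnW n0 nd] := small_inverse d0.
have n0R : 0 < n%:R :> R by rewrite ltr0n.
have key k m : (k + m <= n)%N ->
    let s := [seq i.+1%:R / n%:R | i <- iota k m] in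
    [/\ path <=%R (k%:R / n%:R) s, last (k%:R / n%:R) s = (k + m)%:R / n%:R &
      path_length c (k%:R / n%:R) s = m%:R * (l / n%:R)].
  elim: m k => [|m IH] k; first by rewrite addn0 mul0r.
  rewrite addnS -addSn => /[dup] km /IH /= [ps ls es].
  have kE : k.+1%:R / n%:R = k%:R / n%:R + n%:R^-1 :> R.
    by rewrite -natr1 mulrDl mul1r.
  split=> //; first by rewrite ps andbT kE lerDl invr_ge0 ltW.
  have kn : k.+1%:R / n%:R <= 1 :> R.
    rewrite ler_pdivrMr // mul1r ler_nat; apply: leq_trans km; exact: leq_addr.
  have ni0 : 0 <= n%:R^-1 :> R by rewrite invr_ge0 ltW.
  have kn0 : 0 <= k%:R / n%:R :> R by rewrite mulr_ge0.
  rewrite es cd //; first by rewrite kE -[m.+1%:R]natr1; ring.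
  - by rewrite kE; lra.
  - by rewrite kE; lra.
have [ps ls es] := key 0%N n (leqnn n).
rewrite mul0r divff ?gt_eqF // in ps ls es.
have -> : l = n%:R * (l / n%:R) by rewrite mulrC divfK // gt_eqF.
by rewrite -es; exact: path_length_le_curve_length.
Qed.

End LocalGeodesics.

(** * Critical tuples are strict local minima of the energy *)

Section CriticalTuples.
Context {R : realType} {X : metricType R}.
Local Notation seqX := {ptws nat -> X}.
Implicit Types (x y : nat -> X) (s t : R).

(** For [m] the mean edge this yields the Cauchy-Schwarz inequality between length and energy; for
    [m] the edge of a critical tuple it forces equal edges. *)
Lemma sum_edge_sub N x (m : R) : \sum_(k < N) (edge x k - m) ^+ 2 =
  energy N x - 2 * m * (\sum_(k < N) edge x k) + N%:R * m ^+ 2.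
Proof.
rewrite /energy mulr_sumr -sumrB.
have -> : N%:R * m ^+ 2 = \sum_(k < N) m ^+ 2.
  by rewrite sumr_const card_ord mulr_natl.
by rewrite -big_split; apply: eq_bigr => k _ /=; ring.
Qed.

Context (p q : X) (rho r h : R) (N : nat).
Context (good : segments_on p rho r) (h0 : 0 <= h) (N1 : (1 < N)%N)
  (hrho : N.+1%:R * h <= rho) (hr : 4 * h <= r) (Xproper : proper_space X).
Local Notation T := (tuples p q N h).
Local Notation b := (broken N).

Let N_gt0 : 0 < N%:R :> R.
Proof. by rewrite ltr0n; case: (N) N1. Qed.

Lemma critical_energy x : T x -> critical N x ->
  energy N x = N%:R * edge x 0 ^+ 2.
Proof.
move=> Tx cx; rewrite /energy (eq_bigr (fun=> edge x 0 ^+ 2)).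
  by rewrite sumr_const card_ord mulr_natl.
by move=> k _; rewrite (critical_edge good h0 hrho hr Tx cx).
Qed.

(** Stability says nothing about reparameterizations of [b x]; the energy excludes them. Equal
    length and no more energy force all edges of [y] to equal [edge x 0], so the nodes of [y] sit at
    the parameters [i / N] of [b x]. *)
Lemma reparameterization_broken x y : T x -> critical N x -> T y ->
  reparameterization 0 1 (b x) 0 1 (b y) -> energy N y <= energy N x -> y = x.
Proof.
move=> Tx cx Ty [phi [psi [[cphi mphi phi0 phi1] [cpsi mpsi psi0 psi1] xy]]] Eyx.
have [d d0 gx] := critical_local_geodesic good h0 N1 hrho hr Tx cx.
set l := N%:R * edge x 0 in gx.
have in01 t : 0 <= t -> t <= 1 -> t \in `[0, 1] by move=> t0 t1; rewrite in_itv /= t0.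
have [d' d'0 phid] : exists2 d' : R, 0 < d' & forall s t, 0 <= s <= 1 ->
    `|s - t| < d' -> 0 <= t <= 1 -> `|phi s - phi t| < d.
  have [d' d'0 dP] := itv_uniform_continuity cphi d0.
  by exists d' => // s t s01 st t01; exact: dP.
(* [u i] is a common parameter at which [b y] is at its node [i]. As [psi] may pause it is not
   determined, so the extreme ones are fixed to be 0 and 1. *)
have /choice[u uP] : forall i : nat, exists v : R, (i <= N)%N ->
    [/\ 0 <= v <= 1, psi v = i%:R / N%:R, i = 0%N -> v = 0 & i = N -> v = 1].
  move=> i; have [iN|iN] := leqP i N; last by exists 0.
  have [i0|i0] := eqVneq i 0%N.
    by exists 0 => _; rewrite lexx ler01 i0 psi0 mul0r; split => // N0; move: N1; rewrite -N0.
  have [->|iN'] := eqVneq i N.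
    exists 1 => _; rewrite lexx ler01 psi1 divff ?gt_eqF //; split => // N0.
    by move: N1; rewrite N0.
  have [||v v01 vi] := IVT_curve ler01 cpsi (v := i%:R / N%:R).
  - by rewrite psi0 divr_ge0 // ltW.
  - by rewrite psi1 ler_pdivrMr // mul1r ler_nat.
  by exists v => _; split=> //; [move/eqP: i0|move/eqP: iN'].
have u_mono i : (i < N)%N -> u i <= u i.+1.
  move=> iN; have [u1 p1 _ _] := uP i (ltnW iN); have [u2 p2 _ _] := uP i.+1 iN.
  rewrite leNgt; apply/negP => uu.
  have := mpsi (u i.+1) (u i); rewrite !in_itv /= => /(_ u2 u1 (ltW uu)).
  by rewrite p1 p2 ler_pM2r ?invr_gt0 // ler_nat ltnn.
(* On intervals where [phi] moves by less than [d] the distances along [b x] are exact, and they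
   agree with those along one piece of [b y]; additivity extends this to the whole edge. *)
have step i : (i < N)%N -> l * (phi (u i.+1) - phi (u i)) = edge y i.
  move=> iN; have [/andP[u10 u11] p1 _ _] := uP i (ltnW iN).
  have [/andP[u20 u21] p2 _ _] := uP i.+1 iN.
  have : l * (phi (u i.+1) - phi (u i)) = N%:R * edge y i * (psi (u i.+1) - psi (u i)).
    apply: (@chain_local _ (fun s t => l * (phi t - phi s) =
      N%:R * edge y i * (psi t - psi s)) (u i) (u i.+1) (d' / 2)) => //.
    - by rewrite divr_gt0.
    - by move=> s t v _ _ e1 e2; lra.
    - move=> s t us st tu ts.
      have s01 : 0 <= s <= 1 by apply/andP; split; lra.
      have t01 : 0 <= t <= 1 by apply/andP; split; lra.
      have si : s \in `[0, 1] by rewrite in_itv.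
      have ti : t \in `[0, 1] by rewrite in_itv.
      have z0 : 0 \in `[(0 : R), 1] by rewrite in_itv /= lexx ler01.
      have z1 : 1 \in `[(0 : R), 1] by rewrite in_itv /= lexx ler01.
      have ui : u i \in `[0, 1] by rewrite in_itv /= u10.
      have ui' : u i.+1 \in `[0, 1] by rewrite in_itv /= u20.
      have phist := mphi _ _ si ti st.
      have phi_s0 : 0 <= phi s by rewrite -phi0; apply: mphi => //; case/andP: s01.
      have phi_t1 : phi t <= 1 by rewrite -phi1; apply: mphi => //; case/andP: t01.
      rewrite -gx //; last first.
        have : `|phi s - phi t| < d.
          by apply: phid => //; rewrite ltr_norml; apply/andP; split; lra.
        by rewrite ltr_norml => /andP[]; lra.
      rewrite !xy // (broken_dist good h0 N1 hrho hr (i := i) Ty) //.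
      + have := mpsi _ _ ui si us; rewrite p1 => /(ler_wpM2l (ltW N_gt0)).
        by rewrite mulrCA divff ?mulr1 // gt_eqF.
      + exact: mpsi.
      + have := mpsi _ _ ti ui' tu; rewrite p2 => /(ler_wpM2l (ltW N_gt0)).
        by rewrite mulrCA divff ?mulr1 // gt_eqF.
    - exact: u_mono.
  rewrite p1 p2 => ->; rewrite -mulrBl -natr1.
  have -> : i%:R + 1 - i%:R = 1 :> R by ring.
  by rewrite mul1r mulrAC divff ?mul1r // gt_eqF.
have sumE n : (n <= N)%N -> \sum_(0 <= k < n) edge y k = l * phi (u n).
  elim: n => [|n IH] nN.
    by have [_ _ /(_ erefl) -> _] := uP 0%N nN; rewrite phi0 mulr0 big_geq.
  by rewrite big_nat_recr //= IH ?(ltnW nN) // -step //; ring.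
have Sl : \sum_(k < N) edge y k = l.
  have := sumE N (leqnn N); rewrite big_mkord => ->.
  by have [_ _ _ /(_ erefl) ->] := uP N (leqnn N); rewrite phi1 mulr1.
have edgeE k : (k < N)%N -> edge y k = edge x 0.
  move=> kN; have := sum_edge_sub N y (edge x 0); rewrite Sl => sE.
  have : \sum_(k < N) (edge y k - edge x 0) ^+ 2 <= 0.
    rewrite sE; rewrite (critical_energy Tx cx) in Eyx.
    by rewrite /l; lra.
  rewrite (bigD1 (Ordinal kN)) //= => le0.
  have s1 : 0 <= \sum_(i < N | i != Ordinal kN) (edge y i - edge x 0) ^+ 2.
    by apply: sumr_ge0 => i _; exact: sqr_ge0.
  apply/eqP; rewrite -subr_eq0 -sqrf_eq0 eq_le sqr_ge0 andbT.
  by lra.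
have e00 : 0 <= edge x 0 by exact: mdist_ge0.
apply/funext => n; have [Nn|nN] := leqP N n.
  by have [_ yN _] := Ty; have [_ xN _] := Tx; rewrite yN // xN.
(* At speed 0 parameters cannot be recovered from lengths, but then all nodes equal [p]. *)
have [ez|epos] : edge x 0 = 0 \/ 0 < edge x 0.
  by move: e00; rewrite le_eqVlt => /orP[/eqP <-|]; [left|right].
  have eyz k : (k < N)%N -> y k.+1 = y 0%N.
    elim: k => [|k IH] kN.
      by apply/esym/dist_eq0; rewrite -/(edge y 0) edgeE // ez.
    rewrite -IH ?(ltnW kN) //; apply/esym/dist_eq0.
    by rewrite -/(edge y k.+1) edgeE // ez.
  have exz k : (k < N)%N -> x k.+1 = x 0%N.
    have eE j : (j < N)%N -> edge x j = 0.
      by move=> jN; rewrite (critical_edge good h0 hrho hr Tx cx).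
    elim: k => [|k IH] kN.
      by apply/esym/dist_eq0; rewrite -/(edge x 0) ez.
    rewrite -IH ?(ltnW kN) //; apply/esym/dist_eq0.
    by rewrite -/(edge x k.+1) eE.
  have y0 : y 0%N = p by case: Ty.
  have x0 : x 0%N = p by case: Tx.
  case: n nN => [|n] nN; first by rewrite x0 y0.
  by rewrite eyz ?(ltnW nN) // exz ?(ltnW nN) // x0 y0.
have [u01 pn _ _] := uP n (ltnW nN).
have phin : phi (u n) = n%:R / N%:R.
  have := sumE n (ltnW nN); rewrite big_mkord.
  rewrite (eq_bigr (fun=> edge x 0)); last first.
    by move=> k _; apply: edgeE; exact: ltn_trans (ltn_ord k) nN.
  rewrite sumr_const card_ord -mulr_natl /l => e.
  apply: (mulfI (_ : edge x 0 != 0)); first by rewrite gt_eqF.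
  apply: (mulfI (_ : N%:R != 0)); first by rewrite gt_eqF.
  by rewrite mulrA -e; field; rewrite gt_eqF.
have := xy (u n); rewrite in_itv /= => /(_ u01).
rewrite phin pn (broken_node good h0 N1 hrho hr _ Tx).
by rewrite (broken_node good h0 N1 hrho hr _ Ty).
Qed.

(** Only the finitely many nodes up to [N] matter, so closeness in the product topology suffices. *)
Lemma broken_near (e : R) x : 0 < e -> T x ->
  \forall y \near (x : seqX), T y -> forall t, 0 <= t <= 1 ->
    dist (b x t) (b y t) < e.
Proof.
move=> e0 Tx; have [d d0 dP] := gam_near good Xproper e0.
have nd : \forall y \near (x : seqX),
    forall i : 'I_N.+1, dist (x i) ((y : seqX) (i : nat)) < d.
  apply: (@filter_forall seqX 'I_N.+1 (fun i y => dist (x i) (y i) < d)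
    (nbhs (x : seqX)) (@nbhs_filter seqX x)) => i.
  exact: (cvg_metric_near _ (@continuous_coord _ _ i x) d0).
apply: (@filterS seqX (nbhs (x : seqX)) (@nbhs_filter seqX x) _ _ _ nd).
move=> y yd Ty t /andP[t0 t1].
have [i iN /andP[it ti]] := piece_index N1 t0 t1.
rewrite (broken_piece good h0 hrho hr Tx it ti).
rewrite (broken_piece good h0 hrho hr Ty it ti).
have s01 : 0 <= N%:R * t - i%:R <= 1.
  by rewrite -natr1 in ti; apply/andP; split; lra.
apply: dP => //.
- exact: tuple_region Tx.
- exact: tuple_region Ty.
- exact: tuple_r Tx.
- exact: tuple_r Ty.
- exact: (yd (Ordinal (leqW iN))).
- exact: (yd (Ordinal (iN : (i.+1 < N.+1)%N))).
- by rewrite subrr normr0.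
Qed.

(** Let [y] be near [x] with no more energy. If [b y] is not a reparameterization of [b x],
    stability makes it longer than l = N e, where e is the edge of [x]. The sum S of its edges then
    exceeds l, and by Cauchy-Schwarz its energy is at least S^2/N, more than the energy l^2/N of
    [x]. *)
Lemma critical_strict_min x :
  (forall (a b : R) (c : R -> X), geodesic_segment a b c -> stable a b c) ->
  T x -> critical N x ->
  \forall y \near (x : seqX), T y -> y <> x -> energy N x < energy N y.
Proof.
move=> Xstable Tx cx.
have gx := critical_local_geodesic good h0 N1 hrho hr Tx cx.
have [U [nU UP]] := Xstable _ _ _ (local_geodesic_segment gx).
have /uniform_nbhs[E [entE EU]] := nU.
have [e /= e0 eE] : exists2 e : R, 0 < e & forall z w : X, dist z w < e -> E (z, w).
  move: entE; rewrite -entourage_ballE => -[e /= e0 eE]; exists e => // z w zw.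
  by apply: eE; rewrite /= ballEmdist.
apply: (@filterS seqX (nbhs (x : seqX)) (@nbhs_filter seqX x) _ _ _
  (broken_near e0 Tx)) => y yb Ty yx.
rewrite ltNge; apply/negP => Eyx; apply: yx.
apply: contrapT => yx.
have Uy : U (b y).
  apply: EU => t /=; rewrite in_itv /= => t01; apply: eE; exact: (yb Ty t).
have cby := broken_curve good h0 N1 hrho hr Ty.
have := UP _ Uy; rewrite (broken0 good h0 N1 hrho hr Tx).
rewrite (broken1 good h0 N1 hrho hr Tx) => /(_ cby); case: (pselect (reparameterization 0 1 (b x) 0 1 (b y))).
  move=> rep _; apply: yx; exact: reparameterization_broken rep Eyx.
move=> nrep /(_ nrep).
have := local_geodesic_length gx => /le_lt_trans h1 /h1.
move=> /lt_le_trans /(_ (broken_length_le good h0 N1 hrho hr Ty)).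
rewrite lte_fin; set S := \sum_(k < N) _.
have S0 : 0 <= S by apply: sumr_ge0 => k _; exact: mdist_ge0.
have := sum_edge_sub N y (S / N%:R); rewrite -/S.
have sq : 0 <= \sum_(k < N) (edge y k - S / N%:R) ^+ 2.
  by apply: sumr_ge0 => k _; exact: sqr_ge0.
move=> sE; rewrite sE in sq; rewrite (critical_energy Tx cx) in Eyx.
set m := S / N%:R in sq.
have Sm : S = N%:R * m by rewrite /m mulrC divfK // gt_eqF.
rewrite Sm ltr_pM2l // => em.
have e00 : 0 <= edge x 0 by exact: mdist_ge0.
have : N%:R * m ^+ 2 <= N%:R * edge x 0 ^+ 2 by move: sq; rewrite Sm; lra.
rewrite ler_pM2l // leNgt => /negP; apply.
by rewrite ltr_pXn2r // nnegrE // ltW // (le_lt_trans e00).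
Qed.

Lemma critical_unique x0 x1 (G : set seqX) :
  (forall (a b : R) (c : R -> X), geodesic_segment a b c -> stable a b c) ->
  critical N x0 -> critical N x1 ->
  connected G -> G `<=` T -> G x0 -> G x1 -> x0 = x1.
Proof.
move=> Xstable c0 c1 cG GT G0 G1.
have sp x (Tx : T x) := relax_all_spec good h0 hrho hr Tx.
apply: (@mountain_pass R seqX T (energy N) (relax_all N) x0 x1 G) => //.
- by apply: hausdorff_product => _; exact: metric_hausdorff.
- exact: compact_tuples.
- exact: continuous_subspaceT (@continuous_energy _ _ N).
- exact: (continuous_relax_all good h0 hrho hr Xproper).
- by move=> x Tx; have [] := sp x Tx.
- by move=> x Tx; have [] := sp x Tx.
- by move=> x Tx; have [_ _ h1 h2] := sp x Tx => /h1/h2.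
- move=> x Tx fx; apply: critical_strict_min => //.
  by have [_ _ h1 _] := sp _ Tx; apply: h1; rewrite fx.
- by have [_ _ _] := sp _ (GT _ G0); apply.
- by have [_ _ _] := sp _ (GT _ G1); apply.
Qed.

End CriticalTuples.

(** * Parameterization with constant speed *)

Section ConstantSpeed.
Context {R : realType} {X : metricType R}.
Implicit Types (a b s t u v : R) (c : R -> X).

(** [L] is extended by steps of length [d]: beyond the last node [m] it grows by [dist (c m) (c t)],
    and additivity at scale [d] makes both formulas compatible across [m]. *)
Lemma locally_additive_arclength a b c (d : R) : 0 < d -> a <= b ->
  (forall s u t, a <= s -> s <= u -> u <= t -> t <= b -> t <= s + d ->
     dist (c s) (c t) = dist (c s) (c u) + dist (c u) (c t)) ->
  exists L : R -> R, forall s t, a <= s -> s <= t -> t <= b -> t <= s + d ->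
    dist (c s) (c t) = L t - L s.
Proof.
move=> d0 ab cadd.
have [n nP] : exists n : nat, b <= a + n%:R * d.
  exists (Num.bound ((b - a) / d)).
  have : (b - a) / d < (Num.bound ((b - a) / d))%:R.
    by apply: archi_boundP; apply: divr_ge0; lra.
  by rewrite ltr_pdivrMr //; lra.
have [L LP] : exists L : R -> R, forall s t, a <= s -> s <= t -> t <= b ->
    t <= a + n%:R * d -> t <= s + d -> dist (c s) (c t) = L t - L s.
  elim: n {nP} => [|n [L LP]].
    exists (fun=> 0) => s t a_s st tb; rewrite mul0r addr0 => ta _.
    by have -> : s = t; [apply/eqP; rewrite eq_le st; lra|rewrite subrr mdistxx].
  pose m := a + n%:R * d.
  have am : a <= m by rewrite /m lerDl mulr_ge0 // ltW.
  exists (fun t => if t <= m then L t else L m + dist (c m) (c t)).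
  move=> s t a_s st tb; rewrite -natr1 mulrDl mul1r addrA -/m => tm ts.
  case: (leP t m) => tm'.
    by rewrite (le_trans st tm'); apply: LP.
  case: (leP s m) => sm.
    rewrite (cadd s m t) //; try lra.
    by rewrite (LP s m) // -/m; lra.
  by rewrite (cadd m s t) //; lra.
by exists L => s t a_s st tb ts; apply: LP => //; lra.
Qed.

(** Distances add up along [c] inside each window where it is a shortest path; a Lebesgue number of
    these windows makes this hold at one scale. *)
Lemma geodesic_arclength a b c : length_space X -> geodesic_segment a b c ->
  exists2 d : R, 0 < d & exists L : R -> R,
    forall s t, a <= s -> s <= t -> t <= b -> t <= s + d ->
      dist (c s) (c t) = L t - L s.
Proof.
move=> Xl [[ab cc] _ cmin].
have [|d d0 dP] := @itv_lebesgue_number _ a b (fun s t => forall u,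
    s <= u -> u <= t -> t <= b ->
    dist (c s) (c t) = dist (c s) (c u) + dist (c u) (c t)).
  move=> t0 t0ab; have [|s [t [a_s st tb nst sp]]] := cmin t0; first by rewrite in_itv.
  have [A cA] := shortest_path_arclength Xl sp.
  have := nst; rewrite /within /= => /nbhs_ballP[e /= e0 eP].
  exists e => // u w /andP[au ub] tu tw v uv vw wb.
  have := eP u tu; rewrite !in_itv /= au ub => /(_ isT)/andP[su ut].
  have := eP w tw; rewrite !in_itv /= wb andbT => /(_ (le_trans au (le_trans uv vw))).
  move=> /andP[sw wt].
  by rewrite !cA; lra.
exists (d / 2); first by rewrite divr_gt0.
apply: locally_additive_arclength; [by rewrite divr_gt0|exact: ltW|].
move=> s u t a_s su ut tb ts; apply: dP => //.
  by apply/andP; split; lra.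
by rewrite ltr_norml; apply/andP; split; lra.
Qed.

(** [psi] is the inverse of the arclength [L], rescaled to [0, 1]. Injectivity of [L] is where the
    absence of pauses enters. *)
Lemma geodesic_constant_speed a b c : length_space X -> geodesic_segment a b c ->
  exists2 psi, change_of_parameter 0 1 a b psi &
    exists l, local_geodesic l (c \o psi).
Proof.
move=> Xl gc; have [d d0 [L cL]] := geodesic_arclength Xl gc.
have [[ab cc] np _] := gc.
have Lmono : forall s t, a <= s -> s <= t -> t <= b -> L s <= L t.
  apply: (@chain_local _ (fun s t => L s <= L t) a b d) => //.
    by move=> s t u _ _; exact: le_trans.
  by move=> s t a_s st tb ts; rewrite -subr_ge0 -cL // mdist_ge0.
have cLe : forall s t, a <= s -> s <= t -> t <= b -> dist (c s) (c t) <= L t - L s.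
  apply: (@chain_local _ (fun s t => dist (c s) (c t) <= L t - L s) a b d) => //.
    by move=> s t u _ _ h1 h2; have := metric_triangle (c s) (c t) (c u); lra.
  by move=> s t a_s st tb ts; rewrite cL.
have Lc : {within `[a, b], continuous L}.
  apply/subspace_continuousP => t tab; apply/cvgrPdist_lt => e e0.
  have /subspace_continuousP/(_ t tab) := cc.
  move=> /(cvg_metric_near _)/(_ e0); rewrite !near_withinE => nc.
  near=> s => sab.
  have ts : `|t - s| < d.
    by near: s; apply: cvgr_dist_lt; [exact: cvg_id|].
  have <- : dist (c t) (c s) = `|L t - L s|.
    move: tab sab ts; rewrite /= !in_itv /= ltr_norml.
    move=> /andP[t1 t2] /andP[s1 s2] /andP[h1 h2].
    have [ts|/ltW st] := leP t s.
      by rewrite cL 1?distrC ?ger0_norm ?subr_ge0 ?Lmono //; lra.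
    by rewrite metric_sym cL ?ger0_norm ?subr_ge0 ?Lmono //; lra.
  by move: sab; near: s.
pose l := L b - L a.
have l0 : 0 <= l by rewrite subr_ge0; apply: Lmono => //; exact: ltW.
have [lz|lpos] : l = 0 \/ 0 < l.
  by move: l0; rewrite le_eqVlt => /orP[/eqP <-|]; [left|right].
  (* For a constant curve [L] cannot be inverted; the affine parameter serves. *)
  exists (line_path a b).
    split; rewrite ?line_path0 ?line_path1 //.
      exact/continuous_subspaceT/continuous_line_path.
    by move=> s t _ _; apply: line_path_homo; exact: ltW.
  exists 0, 1 => // s t s0 st t1 _.
  have s01 := clamp_id s0 (le_trans st t1).
  have t01 := clamp_id (le_trans s0 st) t1.
  have := line_path_clamp s (ltW ab); rewrite s01 => /andP[h1 h2].
  have := line_path_clamp t (ltW ab); rewrite t01 => /andP[h3 h4].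
  have st' := line_path_homo (ltW ab) st.
  apply/eqP; rewrite mul0r eq_le mdist_ge0 andbT /=.
  apply: le_trans (cLe _ _ h1 st' h4) _.
  have := Lmono _ _ (lexx a) h1 h2; have := Lmono _ _ h3 h4 (lexx b).
  by rewrite /l in lz; lra.
have Lstrict s t : a <= s -> s < t -> t <= b -> L s < L t.
  move=> a_s st tb; rewrite lt_neqAle Lmono ?(ltW st) // andbT.
  apply/eqP => Lst.
  (* Equal values of [L] mean that [c] rests on [s, t]. It is then constant, and so is [L], against
     [lpos]. *)
  have cst : {in `[a, b], forall u, c u = c a}.
    apply: (np s t) => // u; rewrite in_itv /= => /andP[su ut].
    apply/esym/dist_eq0; apply: le_trans (cLe _ _ _ su _) _ => //; first lra.
    by have := Lmono u t; rewrite Lst subr_le0; apply => //; lra.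
  have : forall v w, a <= v -> v <= w -> w <= b -> L w = L v.
    apply: (@chain_local _ (fun v w => L w = L v) a b d) => //.
      by move=> v w z _ _ -> ->.
    move=> v w av vw wb wv; apply/eqP; rewrite -subr_eq0 -cL //.
    by rewrite !cst ?mdistxx // in_itv /=; apply/andP; split; lra.
  move=> /(_ a b (lexx a) (ltW ab) (lexx b)) Lab.
  by move: lpos; rewrite /l Lab subrr ltxx.
have Linj s t : a <= s <= b -> a <= t <= b -> L s = L t -> s = t.
  move=> /andP[s1 s2] /andP[t1 t2] e; have [st|st|//] := ltgtP s t.
    by have := Lstrict s t s1 st t2; rewrite e ltxx.
  by have := Lstrict t s t1 st s2; rewrite e ltxx.
have /choice[psi psiP] : forall u : R, exists t, 0 <= u <= 1 ->
    a <= t <= b /\ L t = L a + u * l.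
  move=> u; have [/andP[u0 u1]|] := boolP (0 <= u <= 1); last by exists 0.
  have [||t tab Lt] := IVT_curve (ltW ab) Lc (v := L a + u * l).
  - by rewrite lerDl mulr_ge0.
  - by have : u * l <= l by [rewrite ler_piMl]; rewrite /l; lra.
  - by exists t.
have z01 : 0 <= (0 : R) <= 1 by rewrite lexx ler01.
have o01 : 0 <= (1 : R) <= 1 by rewrite lexx ler01.
have aab : a <= a <= b by rewrite lexx ltW.
have bab : a <= b <= b by rewrite lexx ltW.
have psi0 : psi 0 = a.
  by have [h1 h2] := psiP 0 z01; apply: Linj => //; rewrite h2 mul0r addr0.
have psi1 : psi 1 = b.
  by have [h1 h2] := psiP 1 o01; apply: Linj => //; rewrite h2 mul1r /l; lra.
have psi_mono : {in `[0, 1] &, {mono psi : s t / s <= t}}.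
  move=> s t; rewrite !in_itv /= => s01 t01.
  have [/andP[h1 h2] h3] := psiP s s01; have [/andP[h4 h5] h6] := psiP t t01.
  apply/idP/idP => st.
    have := Lmono _ _ h1 st h5.
    by rewrite h3 h6 lerD2l ler_pM2r.
  rewrite leNgt; apply/negP => ts.
  have := Lstrict _ _ h4 ts h2.
  by rewrite h3 h6 ltrD2l ltr_pM2r // ltNge st.
have psi_c : {within `[0, 1], continuous psi}.
  apply: segment_inc_surj_continuous => //.
  rewrite psi0 psi1 => t /=; rewrite in_itv /= => /andP[t1 t2].
  have u01 : 0 <= (L t - L a) / l <= 1.
    have La := Lmono _ _ (lexx a) t1 t2; have Lb := Lmono _ _ t1 t2 (lexx b).
    rewrite ler_pdivrMr // mul1r /l lerD2r Lb andbT.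
    by apply: divr_ge0 => //; rewrite subr_ge0.
  exists ((L t - L a) / l); first by rewrite /= in_itv.
  have [h1 h2] := psiP _ u01; apply: Linj => //; first by rewrite t1.
  by rewrite h2 divfK ?gt_eqF //; ring.
exists psi; first by split=> // s t s01 t01; rewrite psi_mono.
have [d' d'0 psid] := itv_uniform_continuity psi_c d0.
exists l, (d' / 2); first by rewrite divr_gt0.
move=> s t s0 st t1 ts.
have s01 : 0 <= s <= 1 by apply/andP; split; lra.
have t01 : 0 <= t <= 1 by apply/andP; split; lra.
have [/andP[h1 h2] h3] := psiP s s01; have [/andP[h4 h5] h6] := psiP t t01.
have pst : psi s <= psi t by rewrite psi_mono ?in_itv.
rewrite /= cL //; first by rewrite h3 h6; ring.
have : `|psi s - psi t| < d.
  by apply: psid => //; rewrite ltr_norml; apply/andP; split; lra.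
by rewrite ltr_norml => /andP[]; lra.
Unshelve. all: by end_near. Qed.

End ConstantSpeed.

(** * Homotopies *)

Section Homotopies.
Context {R : realType} {X : metricType R}.
Implicit Types (a b s t : R) (c f g : R -> X) (p q : X).

(* Homotopies are defined on the whole plane, so that they can be glued. *)
Definition hom p q f g := exists H : R * R -> X,
  [/\ continuous H,
      forall t, 0 <= t <= 1 -> H (0, t) = f t /\ H (1, t) = g t,
      forall s t, t <= 0 -> H (s, t) = p &
      forall s t, 1 <= t -> H (s, t) = q].

Lemma continuous_pair {T U V : topologicalType} (u : T -> U) (v : T -> V) :
  continuous u -> continuous v -> continuous (fun z => (u z, v z)).
Proof. by move=> cu cv z; apply: cvg_pair; [exact: cu|exact: cv]. Qed.

Lemma continuous_compose {T U V : topologicalType} (u : T -> U) (v : U -> V) :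
  continuous u -> continuous v -> continuous (fun z => v (u z)).
Proof.
by move=> cu cv z; apply: (@continuous_comp _ _ _ u v); [exact: cu|exact: cv].
Qed.

Lemma continuous_pfst {U V : topologicalType} : continuous (@fst U V).
Proof. by move=> z; exact: cvg_fst. Qed.

Lemma continuous_psnd {U V : topologicalType} : continuous (@snd U V).
Proof. by move=> z; exact: cvg_snd. Qed.

Lemma hom_sym p q f g : hom p q f g -> hom p q g f.
Proof.
move=> [H [cH H01 Hp Hq]]; exists (fun z => H (1 - z.1, z.2)); split.
- apply: (continuous_compose (u := fun z : R * R => (1 - z.1, z.2))) => //.
  apply: continuous_pair; last exact: continuous_psnd.
  by move=> z; apply: cvgB; [exact: cvg_cst|exact: cvg_fst].
- by move=> t t01; rewrite /= subr0 subrr; have [] := H01 t t01.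
- by move=> s t t0; exact: Hp.
- by move=> s t t1; exact: Hq.
Qed.

Lemma hom_trans p q f g k : hom p q f g -> hom p q g k -> hom p q f k.
Proof.
move=> [H [cH H01 Hp Hq]] [K [cK K01 Kp Kq]].
exists (fun z => if z.1 - 1 / 2 <= 0 then H (2 * z.1, z.2) else K (2 * z.1 - 1, z.2)).
split.
- apply: (@continuous_glue R _ _ (fun z : R * R => H (2 * z.1, z.2))
    (fun z => K (2 * z.1 - 1, z.2)) (fun z => z.1 - 1 / 2)).
  + apply: (continuous_compose (u := fun z : R * R => (2 * z.1, z.2))) => //.
    apply: continuous_pair; last exact: continuous_psnd.
    by move=> z; apply: cvgM; [exact: cvg_cst|exact: cvg_fst].
  + apply: (continuous_compose (u := fun z : R * R => (2 * z.1 - 1, z.2))) => //.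
    apply: continuous_pair; last exact: continuous_psnd.
    move=> z; apply: cvgB; last exact: cvg_cst.
    by apply: cvgM; [exact: cvg_cst|exact: cvg_fst].
  + by move=> z; apply: cvgB; [exact: cvg_fst|exact: cvg_cst].
  (* The halves must agree on the whole line s = 1/2; outside [0, 1] both are [p] or both are
     [q]. *)
  + move=> [s t] /= s0.
    have -> : 2 * s - 1 = 0 by lra.
    have -> : 2 * s = 1 by lra.
    have [t0|t0] := leP t 0; first by rewrite Hp // Kp.
    have [t1|t1] := leP 1 t; first by rewrite Hq // Kq.
    have t01 : 0 <= t <= 1 by rewrite !ltW.
    by have [_ ->] := H01 t t01; have [->] := K01 t t01.
- move=> t t01 /=; rewrite ifT; last by lra.
  rewrite mulr0 ifF; last by apply/negbTE; rewrite -ltNge; lra.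
  rewrite (_ : 2 * 1 - 1 = 1); last by ring.
  by have [-> _] := H01 t t01; have [_ ->] := K01 t t01.
- by move=> s t t0 /=; rewrite Hp // Kp // if_same.
- by move=> s t t1 /=; rewrite Hq // Kq // if_same.
Qed.

Lemma hom_homotopic p q a b c a' b' c' :
  hom p q (c \o line_path a b) (c' \o line_path a' b') ->
  homotopic p q a b c a' b' c'.
Proof.
move=> [H [cH H01 Hp Hq]]; exists H; split.
- exact: continuous_subspaceT.
- by move=> t; rewrite in_itv /= => /H01[].
- by move=> t; rewrite in_itv /= => /H01[].
- by move=> s _; exact: Hp.
- by move=> s _; exact: Hq.
Qed.

Lemma homotopic_hom p q a b c a' b' c' : homotopic p q a b c a' b' c' ->
  hom p q (c \o line_path a b) (c' \o line_path a' b').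
Proof.
move=> [H [cH H0 H1 Hp Hq]].
exists (fun z => H (clamp 0 1 z.1, clamp 0 1 z.2)); split.
- apply: (continuous_comp_within cH (g := fun z => (clamp 0 1 z.1, clamp 0 1 z.2))).
    apply: continuous_pair; apply: (continuous_compose _ (@continuous_clamp _ _ _)).
      exact: continuous_pfst.
    exact: continuous_psnd.
  by move=> z /=; split; rewrite /= in_itv /= clamp_in.
- move=> t t01; case/andP: (t01) => t0 t1; rewrite /= (clamp_id t0 t1).
  by rewrite clamp_l // clamp_r // H0 ?H1 // in_itv.
- by move=> s t t0 /=; rewrite (clamp_l _ t0) // Hp // in_itv /= clamp_in.
- by move=> s t t1 /=; rewrite (clamp_r _ t1) // Hq // in_itv /= clamp_in.
Qed.

(** Straight-line homotopy between the two parameters, which stays in [a, b] by convexity. *)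
Lemma hom_reparam a b c (psi : R -> R) : curve a b c ->
  change_of_parameter 0 1 a b psi ->
  hom (c a) (c b) (c \o line_path a b) (c \o psi).
Proof.
move=> [ab cc] [cpsi mpsi psi0 psi1].
pose w (z : R * R) := (1 - clamp 0 1 z.1) * line_path a b (clamp 0 1 z.2) +
  clamp 0 1 z.1 * psi (clamp 0 1 z.2).
have psi_in t : a <= psi (clamp 0 1 t) <= b.
  have t01 := clamp_in t (@ler01 R); case/andP: (t01) => h0 h1.
  by rewrite -{1}psi0 -psi1 !mpsi ?in_itv /= ?lexx ?ler01.
have c1 : continuous (fun z : R * R => clamp 0 1 z.1).
  apply: (continuous_compose _ (@continuous_clamp _ _ _)).
  exact: continuous_pfst.
have c2 : continuous (fun z : R * R => clamp 0 1 z.2).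
  apply: (continuous_compose _ (@continuous_clamp _ _ _)).
  exact: continuous_psnd.
have c3 : continuous (fun z : R * R => psi (clamp 0 1 z.2)).
  apply: (continuous_comp_within cpsi (g := fun z => clamp 0 1 z.2)) => // z /=.
  by rewrite in_itv /= clamp_in.
have c4 := continuous_compose c2 (@continuous_line_path _ a b).
exists (fun z => c (w z)); split.
- apply: (continuous_comp_within cc (g := w)).
    move=> z; apply: cvgD; apply: cvgM; [|exact: c4|exact: c1|exact: c3].
    by apply: cvgB; [exact: cvg_cst|exact: c1].
  move=> z; rewrite /= in_itv /= /w.
  have /andP[h1 h2] := psi_in z.2.
  have /andP[h3 h4] := line_path_clamp z.2 (ltW ab).
  have /andP[h5 h6] := clamp_in z.1 (@ler01 R).
  by apply/andP; split; nra.
- move=> t /andP[t0 t1]; rewrite /w /= (clamp_id t0 t1) clamp_l // clamp_r //.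
  by split; congr c; ring.
- move=> s t t0; rewrite /w /= (clamp_l _ t0) // line_path0 psi0.
  by congr c; ring.
- move=> s t t1; rewrite /w /= (clamp_r _ t1) // line_path1 psi1.
  by congr c; ring.
Qed.

(** [f t] and [g t] are joined by their short segment, which depends continuously on [t] and is
    constant at the common ends. *)
Lemma hom_near p q (rho r : R) f g : proper_space X -> segments_on p rho r ->
  curve_between 0 1 f p q -> curve_between 0 1 g p q ->
  (forall t, 0 <= t <= 1 -> dist p (f t) <= rho /\ dist (f t) (g t) <= r) ->
  hom p q f g.
Proof.
move=> Xp good [[_ cf] f0 f1] [[_ cg] g0 g1] fg.
have cl (t : R) := clamp_in t (@ler01 R).
exists (fun z => gam (f (clamp 0 1 z.2)) (g (clamp 0 1 z.2)) (clamp 0 1 z.1)).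
have c1 : continuous (fun z : R * R => clamp 0 1 z.1).
  apply: (continuous_compose _ (@continuous_clamp _ _ _)).
  exact: continuous_pfst.
have c2 (k : R -> X) : {within `[0, 1], continuous k} ->
    continuous (fun z : R * R => k (clamp 0 1 z.2)).
  move=> ck; apply: (continuous_compose (v := k \o clamp 0 1) (@continuous_psnd _ _)).
  exact: continuous_clamped.
have fgc t := fg _ (cl t).
split.
- move=> z; apply: (cvg_gam good _ Xp (c2 f cf z) (c2 g cg z) (c1 z)).
  + by have [] := fgc z.2.
  + by have [] := fgc z.2.
  + exact: cl.
  + by apply: nearW => w; have [h1 h2] := fgc w.2; split.
- move=> t t01; case/andP: (t01) => t0 t1; have [h1 h2] := fg t t01.
  by rewrite /= (clamp_id t0 t1) clamp_l // clamp_r // (gam0 good) // (gam1 good).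
- move=> s t t0; rewrite /= (clamp_l _ t0) // f0 g0; apply/esym/(gam_unique good).
  + by have [] := fg 0 (introT andP (conj (lexx 0) ler01)); rewrite f0.
  + by have [_] := fg 0 (introT andP (conj (lexx 0) ler01)); rewrite f0 g0.
  + exact: cl.
  + by split; rewrite mdistxx mulr0.
- move=> s t t1; rewrite /= (clamp_r _ t1) // f1 g1; apply/esym/(gam_unique good).
  + by have [] := fg 1 (introT andP (conj ler01 (lexx 1))); rewrite f1.
  + by have [_] := fg 1 (introT andP (conj ler01 (lexx 1))); rewrite f1 g1.
  + exact: cl.
  + by split; rewrite mdistxx mulr0.
Qed.

Lemma homotopy_bound p (H : R * R -> X) : continuous H -> exists2 rho : R, 0 < rho &
  forall s t, 0 <= s <= 1 -> 0 <= t <= 1 -> dist p (H (s, t)) <= rho.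
Proof.
move=> cH; pose I := `[(0 : R), 1]%classic.
have cI : compact (I `*` I) by apply: compact_setX; exact: segment_compact.
have I0 : I `*` I !=set0 by exists (0, 0); split; rewrite /I /= in_itv /= lexx ler01.
have cd : {within I `*` I, continuous (fun z => dist p (H z))}.
  by apply: continuous_subspaceT => z; apply: cvg_dist; [exact: cvg_cst|exact: cH].
have [m _ mP] := compact_EVT_max I0 cI cd.
exists (dist p (H m) + 1); first by have := mdist_ge0 p (H m); lra.
move=> s t s01 t01; have := mP (s, t); rewrite inE => h.
have : dist p (H (s, t)) <= dist p (H m) by apply: h; split; rewrite /I /= in_itv.
by lra.
Qed.

(** Provides one sampling mesh for all curves of the homotopy. *)
Lemma homotopy_uniform (H : R * R -> X) (e : R) : continuous H -> 0 < e ->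
  exists2 d : R, 0 < d & forall s t t', 0 <= s <= 1 -> 0 <= t <= 1 ->
    `|t - t'| <= d -> dist (H (s, t)) (H (s, t')) < e.
Proof.
move=> cH e0; pose I := `[(0 : R), 1]%classic.
have : compact (I `*` I) by apply: compact_setX; exact: segment_compact.
move=> /compact_near_coveringP cI.
have := cI R (0:R)^'+ (fun (d : R) (z : R * R) =>
  forall t', `|z.2 - t'| < d -> dist (H z) (H (z.1, t')) < e) _.
case.
  move=> z _; have e2 : 0 < e / 2 by rewrite divr_gt0.
  have /nbhs_ballP[d /= d0 dP] : nbhs z [set w | dist (H z) (H w) < e / 2].
    exact: (cvg_metric_near _ (cH z) e2).
  exists (ball z (d / 2), [set k : R | 0 < k < d / 2]) => /=.
    split; first by apply: nbhsx_ballx; rewrite divr_gt0.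
    near=> k; apply/andP; split; near: k; first exact: nbhs_right_gt.
    by apply: nbhs_right_lt; rewrite divr_gt0.
  move=> [w k] /= [[zw1 zw2] /andP[k0 kd]] t' wt'.
  have h1 : dist (H z) (H w) < e / 2.
    by apply: dP; split; apply: le_ball (zw1) || apply: le_ball (zw2); lra.
  have h2 : dist (H z) (H (w.1, t')) < e / 2.
    apply: dP; split => /=; first by apply: le_ball zw1; lra.
    move: zw2; rewrite /ball /= => zw2.
    by have := ler_distD w.2 z.2 t'; lra.
  have := metric_triangle (H w) (H z) (H (w.1, t')).
  by rewrite (metric_sym (H w) (H z)); lra.
rewrite /= => d0 [/= d0P dP].
exists (d0 / 4); first by rewrite divr_gt0.
move=> s t t' s01 t01 tt'; apply: (dP (d0 / 2) _ _ (s, t)) => /=.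
- by rewrite sub0r normrN gtr0_norm; lra.
- by lra.
- by split; rewrite /I /= in_itv.
- by lra.
Unshelve. all: by end_near. Qed.

End Homotopies.

(** * Geodesic subdivision of a sequence of points *)

Section Refinement.
Context {R : realType} {X : metricType R}.
Implicit Types (y : nat -> X) (s t : R).

Definition refine k y : nat -> X := fun i =>
  gam (y (i %/ k)%N) (y (i %/ k).+1) ((i %% k)%N%:R / k%:R).

Context (p q : X) (rho r e : R) (k M : nat) (good : segments_on p rho r)
  (k0 : (0 < k)%N) (er : e <= r).

Let k_gt0 : 0 < k%:R :> R.
Proof. by rewrite ltr0n. Qed.

Let mod01 i : 0 <= ((i %% k)%N%:R / k%:R : R) <= 1.
Proof.
apply/andP; split; first by rewrite mulr_ge0 // invr_ge0 ltW.
by rewrite ler_pdivrMr // mul1r ler_nat ltnW // ltn_pmod.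
Qed.

Context (y : nat -> X) (yrho : forall j, dist p (y j) <= rho)
  (ye : forall j, dist (y j) (y j.+1) <= e).

Let yr j : dist (y j) (y j.+1) <= r.
Proof. exact: le_trans (ye j) er. Qed.

(** The last point of a block is the first of the next one, so the edge from [i] to [i.+1] can
    always be read on a single segment. *)
Lemma refine_succ i : refine k y i.+1 =
  gam (y (i %/ k)%N) (y (i %/ k).+1) ((i %% k).+1%:R / k%:R).
Proof.
have iE := divn_eq i k; have mk := ltn_pmod i k0.
have [mk'|mk'] := ltnP (i %% k).+1 k.
  have sE : i.+1 = ((i %/ k) * k + (i %% k).+1)%N by rewrite addnS -iE.
  rewrite /refine; have -> : (i.+1 %/ k = i %/ k)%N.
    by rewrite {1}sE divnMDl // (divn_small mk') addn0.
  by have -> : (i.+1 %% k = (i %% k).+1)%N by rewrite {1}sE modnMDl (modn_small mk').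
have mE : (i %% k).+1 = k by apply/eqP; rewrite eqn_leq mk.
have sE : i.+1 = ((i %/ k).+1 * k)%N by rewrite mulSn {1}iE -addnS mE addnC.
rewrite /refine mE divff ?gt_eqF // (gam1 good) //.
have -> : (i.+1 %/ k = (i %/ k).+1)%N by rewrite {1}sE mulnK.
have -> : (i.+1 %% k = 0)%N by rewrite {1}sE modnMl.
by rewrite mul0r (gam0 good).
Qed.

Lemma refine_edge i : dist (refine k y i) (refine k y i.+1) <= e / k%:R.
Proof.
have h : 0 <= ((i %% k).+1%:R / k%:R : R) <= 1.
  apply/andP; split; first by rewrite mulr_ge0 // invr_ge0 ltW.
  by rewrite ler_pdivrMr // mul1r ler_nat ltn_pmod.
rewrite refine_succ /refine (gam_dist good) // -mulrBl -natr1 opprD addrA.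
rewrite subrr add0r normrM normrN normr1 mul1r gtr0_norm ?invr_gt0 //.
by rewrite mulrC ler_pM2r ?invr_gt0.
Qed.

Lemma refine_near i : dist (y (i %/ k)%N) (refine k y i) <= e.
Proof.
rewrite /refine.
have [-> _] := between_eq
  (gam_between good (yrho (i %/ k)%N) (yr (i %/ k)%N) (mod01 i)).
have := mod01 i; set m := _ / _ => /andP[m0 m1].
apply: le_trans (ye (i %/ k)%N); rewrite ler_piMl //; exact: mdist_ge0.
Qed.

Lemma refine_tuple : y 0%N = p -> (forall j, (M <= j)%N -> y j = q) ->
  tuples p q (k * M) (e / k%:R) (refine k y).
Proof.
move=> y0 yM; split; last exact: refine_edge.
- by rewrite /refine div0n mod0n mul0r (gam0 good).
- move=> i; rewrite mulnC -leq_divRL // => Mi.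
  have := yrho (i %/ k)%N; rewrite /refine !yM // ?leqW // => qrho.
  have qr : dist q q <= r by have := yr (i %/ k)%N; rewrite !yM // ?leqW.
  apply/esym/(gam_unique good) => //.
  by split; rewrite mdistxx mulr0.
Qed.

End Refinement.

(** * Existence and uniqueness in a homotopy class *)

Section Main.
Context {R : realType} {X : metricType R}.
Local Notation seqX := {ptws nat -> X}.
Implicit Types (s t u v : R) (c f g : R -> X) (p q : X).
Context (Xproper : proper_space X) (Xlength : length_space X)
  (Xunique : locally_unique_geodesics X).

Lemma local_geodesic_between l f (d : R) s u v t :
  (forall s t, 0 <= s -> s <= t -> t <= 1 -> t <= s + d ->
    dist (f s) (f t) = l * (t - s)) ->
  0 <= u -> u <= v -> v <= 1 -> v <= u + d -> 0 <= s <= 1 ->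
  t = u + s * (v - u) -> between s (f u) (f v) (f t).
Proof.
move=> fl u0 uv v1 vu /andP[s0 s1] tE.
have ut : u <= t by rewrite tE lerDl mulr_ge0 ?subr_ge0.
have tv : t <= v by rewrite tE; nra.
by rewrite /between !fl //; try lra; rewrite tE; split; lra.
Qed.

(** The neighbours of a node are [2 / N] apart in parameter, within the scale [d], so the node is
    the midpoint of the segment between them. *)
Lemma local_geodesic_critical p q (rho r h l : R) (N : nat) f (x : nat -> X)
    (d : R) :
  segments_on p rho r -> 0 <= h -> (1 < N)%N -> N.+1%:R * h <= rho ->
  4 * h <= r -> tuples p q N h x ->
  (forall s t, 0 <= s -> s <= t -> t <= 1 -> t <= s + d ->
    dist (f s) (f t) = l * (t - s)) ->
  2 / N%:R <= d -> (forall i, (i <= N)%N -> x i = f (i%:R / N%:R)) ->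
  critical N x.
Proof.
move=> good h0 N1 hrho hr Tx fl Nd xf i iN.
have N0 : 0 < N%:R :> R by rewrite ltr0n ltnW.
apply: (gam_unique good).
- exact: (tuple_region h0 hrho _ Tx).
- exact: (tuple_r2 h0 hr _ Tx).
- by apply/andP; split; lra.
have Ni0 : 0 < N%:R^-1 :> R by rewrite invr_gt0.
rewrite !xf //; try exact: ltnW; last exact: ltnW (ltnW iN).
have e2 : i.+2%:R / N%:R = i%:R / N%:R + 2 / N%:R :> R.
  by rewrite -!natr1; ring.
apply: (local_geodesic_between (d := d) (l := l)) => //.
- by rewrite e2; lra.
- by rewrite ler_pdivrMr // mul1r ler_nat.
- by rewrite e2; lra.
- by apply/andP; split; lra.
- by rewrite e2 -natr1; lra.
Qed.

(** Arcs of parameter length [1 / M] are short segments, so subdividing the samples at step [1 / M]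
    gives the samples at the finer step. *)
Lemma local_geodesic_refine p (rho r l : R) (k M : nat) f (d : R) i :
  segments_on p rho r -> (0 < k)%N -> (0 < M)%N ->
  (forall j, (j <= M)%N -> dist p (f (j%:R / M%:R)) <= rho) ->
  (forall j, (j < M)%N -> dist (f (j%:R / M%:R)) (f (j.+1%:R / M%:R)) <= r) ->
  (forall s t, 0 <= s -> s <= t -> t <= 1 -> t <= s + d ->
    dist (f s) (f t) = l * (t - s)) ->
  M%:R^-1 <= d -> (i < k * M)%N ->
  f (i%:R / (k * M)%N%:R) = refine k (fun j => f (j%:R / M%:R)) i.
Proof.
move=> good k0 M0 frho fr fl Md ikM.
have k0R : 0 < k%:R :> R by rewrite ltr0n.
have M0R : 0 < M%:R :> R by rewrite ltr0n.
have jM : (i %/ k < M)%N by rewrite ltn_divLR // mulnC.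
have s01 : 0 <= ((i %% k)%N%:R / k%:R : R) <= 1.
  apply/andP; split; first by rewrite mulr_ge0 // invr_ge0 ltW.
  by rewrite ler_pdivrMr // mul1r ler_nat ltnW // ltn_pmod.
apply: (gam_unique good) => //; first by apply: frho; exact: ltnW.
  exact: fr.
have Mi0 : 0 < M%:R^-1 :> R by rewrite invr_gt0.
have e1 : (i %/ k).+1%:R / M%:R = (i %/ k)%N%:R / M%:R + M%:R^-1 :> R.
  by rewrite -natr1 mulrDl mul1r.
apply: (local_geodesic_between (d := d) (l := l)) => //.
- by rewrite e1; lra.
- by rewrite ler_pdivrMr // mul1r ler_nat.
- by rewrite e1; lra.
rewrite e1 {1}(divn_eq i k) natrD !natrM.
by field; rewrite !gt_eqF.
Qed.

(** Equality of the end tuples gives equality of the curves, since between consecutive nodes both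
    run along the unique short segment. *)
Lemma hom_local_geodesic_eq p q f g (l l' : R) :
  (forall (a b : R) (c : R -> X), geodesic_segment a b c -> stable a b c) ->
  f 0 = p -> f 1 = q -> g 0 = p -> g 1 = q ->
  local_geodesic l f -> local_geodesic l' g -> hom p q f g ->
  forall t, 0 <= t <= 1 -> f t = g t.
Proof.
move=> Xstable f0 f1 g0 g1 [df df0 fl] [dg dg0 gl] [H [cH H01 Hp Hq]].
have [rho0 _ rho0P] := homotopy_bound p cH.
have [r0 r00 good0] := uniform_unique_segment p rho0 Xproper Xlength Xunique.
have [d d0 dP] := homotopy_uniform cH r00.
have [M M1 Md] : exists2 M : nat, (1 < M)%N &
    [/\ M%:R^-1 <= d, M%:R^-1 <= df & M%:R^-1 <= dg].
  have [|M M1 Md] := @small_inverse _ (Order.min d (Order.min df dg)).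
    by rewrite !lt_min d0 df0.
  by exists M => //; move: Md; rewrite !le_min => /and3P.
have [Md1 Mdf Mdg] := Md.
have M0 := ltnW M1.
have M0R : 0 < M%:R :> R by rewrite ltr0n.
(* Arbitrary tuples, unlike those sampled from [H], may go as far as [M * r0] from [p]; this larger
   ball has a radius of its own. *)
have [r1 r10 good1] :=
  uniform_unique_segment p (M.+1%:R * r0) Xproper Xlength Xunique.
(* Chosen for [4 * h <= r1]. Moreover [1 < k] gives [2 / N <= 1 / M], by which the samples of [f]
   and [g] are critical. *)
have [k k1 kr] := small_inverse (divr_gt0 r10 (mulr_gt0 (ltr0n _ 4) r00)).
have k0 := ltnW k1.
have k0R : 0 < k%:R :> R by rewrite ltr0n.
pose h := r0 / k%:R; pose N := (k * M)%N.
have h0 : 0 <= h by rewrite /h divr_ge0 // ltW.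
have hr0 : h <= r0.
  by rewrite /h ler_pdivrMr // ler_peMr ?(ltW r00) // ler1n.
have hr : 4 * h <= r1.
  have : 4 * r0 * k%:R^-1 <= 4 * r0 * (r1 / (4 * r0)) by rewrite ler_pM2l // mulr_gt0.
  rewrite [4 * r0 * (_ / _)]mulrC divfK ?gt_eqF ?mulr_gt0 //.
  by rewrite /h mulrA.
have NhE : N%:R * h = M%:R * r0.
  by rewrite /N /h natrM; field; rewrite gt_eqF.
have hrho : N.+1%:R * h <= M.+1%:R * r0.
  by rewrite -!natr1 !mulrDl NhE !mul1r lerD2l.
have N1 : (1 < N)%N by rewrite /N (leq_trans k1) // leq_pmulr.
have N0R : 0 < N%:R :> R by rewrite ltr0n ltnW.
pose Y s j := H (clamp 0 1 s, j%:R / M%:R).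
have cl s := clamp_in s (@ler01 R).
have jM01 j : (j <= M)%N -> 0 <= (j%:R / M%:R : R) <= 1.
  move=> jM; apply/andP; split; first by rewrite mulr_ge0 // invr_ge0 ltW.
  by rewrite ler_pdivrMr // mul1r ler_nat.
have Yq s j : (M <= j)%N -> Y s j = q.
  by move=> Mj; apply: Hq; rewrite ler_pdivlMr // mul1r ler_nat.
have Yp s : Y s 0%N = p by apply: Hp; rewrite mul0r.
have Yrho s j : dist p (Y s j) <= rho0.
  have [jM|/ltnW Mj] := leqP j M; first exact: rho0P (cl s) (jM01 j jM).
  by rewrite Yq // -(Yq s M) //; exact: rho0P (cl s) (jM01 M (leqnn M)).
have Ye s j : dist (Y s j) (Y s j.+1) <= r0.
  have [Mj|jM] := leqP M j; first by rewrite !Yq ?mdistxx ?(ltW r00) // leqW.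
  apply/ltW/dP; [exact: cl|exact: jM01 (ltnW jM)|].
  by rewrite -mulrBl -natr1 opprD addrA subrr add0r mulN1r normrN ger0_norm.
pose Gam s := refine k (Y s) : seqX.
have TGam s : tuples p q N h (Gam s).
  by apply: (refine_tuple good0 k0 (lexx r0)) => //; exact: Yq.
have cGam : continuous Gam.
  move=> s; apply: cvg_coords => i.
  have cY j : continuous (fun s => Y s j).
    have cu : continuous (fun s : R => (clamp 0 1 s, (j%:R / M%:R : R))).
      apply: continuous_pair; first exact: continuous_clamp.
      by move=> z; exact: cvg_cst.
    exact: (continuous_compose cu cH).
  apply: (cvg_gam good0 _ Xproper (cY _ s) (cY _ s) (cvg_cst _)) => //.
  + apply/andP; split; first by rewrite mulr_ge0 // invr_ge0 ltW.
    by rewrite ler_pdivrMr // mul1r ler_nat ltnW // ltn_pmod.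
  + apply: nearW => z; split => //.
    apply/andP; split; first by rewrite mulr_ge0 // invr_ge0 ltW.
    by rewrite ler_pdivrMr // mul1r ler_nat ltnW // ltn_pmod.
pose G : set seqX := Gam @` `[0, 1]%classic.
have cG : connected G.
  apply: connected_continuous_connected; first exact: segment_connected.
  exact: continuous_subspaceT.
have GT : G `<=` tuples p q N h by move=> _ [s _ <-].
(* Serves both ends of the path: [c0] is [f] at [s = 0] and [g] at [s = 1]. *)
have GamE c0 (l0 dc s : R) : (forall t, 0 <= t <= 1 -> H (clamp 0 1 s, t) = c0 t) ->
    c0 1 = q -> M%:R^-1 <= dc -> (forall s t, 0 <= s -> s <= t -> t <= 1 ->
      t <= s + dc -> dist (c0 s) (c0 t) = l0 * (t - s)) ->
    (forall i, (i <= N)%N -> Gam s i = c0 (i%:R / N%:R)) /\ critical N (Gam s).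
  move=> Hc c01 Mdc c0l.
  have YE j : (j <= M)%N -> Y s j = c0 (j%:R / M%:R) by move=> /jM01; exact: Hc.
  have GE i : (i <= N)%N -> Gam s i = c0 (i%:R / N%:R).
    rewrite leq_eqVlt => /orP[/eqP ->|iN].
      by rewrite divff ?gt_eqF // c01; have [_ ->] := TGam s.
    rewrite (local_geodesic_refine good0 k0 M0 _ _ c0l) //.
    - have jM : (i %/ k < M)%N by rewrite ltn_divLR // mulnC.
      by rewrite /Gam /refine !YE // ltnW.
    - by move=> j jM; rewrite -YE.
    - by move=> j jM; rewrite -!YE // ltnW.
  split=> //; apply: (local_geodesic_critical good1 h0 N1 hrho hr (TGam s) c0l) => //.
  apply: le_trans Mdc; rewrite /N natrM ler_pdivrMr ?mulr_gt0 //.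
  by rewrite mulrCA mulVf ?gt_eqF // mulr1 ler_nat.
have z01 : 0 <= (0 : R) <= 1 by rewrite lexx ler01.
have o01 : 0 <= (1 : R) <= 1 by rewrite lexx ler01.
have [|E0 crit0] := GamE f l df 0 _ f1 Mdf fl.
  by move=> t /H01[]; rewrite clamp_l.
have [|E1 crit1] := GamE g l' dg 1 _ g1 Mdg gl.
  by move=> t /H01[]; rewrite clamp_r.
have G01 : Gam 0 = Gam 1.
  apply: (critical_unique good1 h0 N1 hrho hr Xproper Xstable crit0 crit1 cG GT).
    by exists 0; rewrite //= in_itv.
  by exists 1; rewrite //= in_itv.
move=> t /andP[t0 t1]; have [i iN /andP[it ti]] := piece_index N1 t0 t1.
have s01 : 0 <= N%:R * t - i%:R <= 1.
  by rewrite -natr1 in ti; apply/andP; split; lra.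
have NM : N%:R^-1 <= M%:R^-1 :> R.
  by rewrite lef_pV2 ?posrE // ler_nat /N leq_pmull.
have bet c0 (l0 dc : R) : M%:R^-1 <= dc -> (forall s t, 0 <= s -> s <= t -> t <= 1 ->
      t <= s + dc -> dist (c0 s) (c0 t) = l0 * (t - s)) ->
    between (N%:R * t - i%:R) (c0 (i%:R / N%:R)) (c0 (i.+1%:R / N%:R)) (c0 t).
  move=> Mdc c0l.
  have Ni0 : 0 < N%:R^-1 :> R by rewrite invr_gt0.
  have e1 : i.+1%:R / N%:R = i%:R / N%:R + N%:R^-1 :> R.
    by rewrite -natr1 mulrDl mul1r.
  apply: (local_geodesic_between (d := dc) (l := l0)) => //.
  - by rewrite e1; lra.
  - by rewrite ler_pdivrMr // mul1r ler_nat.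
  - by rewrite e1; lra.
  - by rewrite e1; field; rewrite gt_eqF.
have bf := bet f l df Mdf fl; have bg := bet g l' dg Mdg gl.
rewrite -E0 ?(ltnW iN) // -E0 // in bf; rewrite -E1 ?(ltnW iN) // -E1 // -G01 in bg.
have reg := tuple_region h0 hrho i (TGam 0); have len := tuple_r h0 hr i (TGam 0).
by rewrite (gam_unique good1 reg len s01 bf) (gam_unique good1 reg len s01 bg).
Qed.

Lemma hom_local_geodesic_exists p q f : continuous f ->
  (forall t, t <= 0 -> f t = p) -> (forall t, 1 <= t -> f t = q) ->
  exists2 g, hom p q f g & exists l, [/\ local_geodesic l g, g 0 = p & g 1 = q].
Proof.
(* The constant homotopy makes the bounds for homotopies available for the single curve [f]. *)
move=> cf fp fq; pose H (z : R * R) := f z.2.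
have cH : continuous H by apply: continuous_compose => //; exact: continuous_psnd.
have [rho0 _ rho0P] := homotopy_bound p cH.
have [r0 r00 good0] := uniform_unique_segment p rho0 Xproper Xlength Xunique.
(* Three errors of at most [e] separate [f] from the broken geodesic of its subdivided samples:
   sampling, subdivision, and one piece. Their sum stays below [r0]. *)
pose e := r0 / 4; have e0 : 0 < e by rewrite divr_gt0.
have er0 : e <= r0 by rewrite /e; lra.
have [d d0 dP] := homotopy_uniform cH e0.
have [M M1 Md] := small_inverse d0.
have M0 := ltnW M1; have M0R : 0 < M%:R :> R by rewrite ltr0n.
have [r1 r10 good1] :=
  uniform_unique_segment p (M.+1%:R * e) Xproper Xlength Xunique.
have [k k1 kr] := small_inverse (divr_gt0 r10 (mulr_gt0 (ltr0n _ 4) e0)).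
have k0 := ltnW k1; have k0R : 0 < k%:R :> R by rewrite ltr0n.
pose h := e / k%:R; pose N := (k * M)%N.
have h0 : 0 <= h by rewrite /h divr_ge0 // ltW.
have he : h <= e.
  by rewrite /h ler_pdivrMr // ler_peMr ?(ltW e0) // ler1n.
have hr : 4 * h <= r1.
  have : 4 * e * k%:R^-1 <= 4 * e * (r1 / (4 * e)) by rewrite ler_pM2l // mulr_gt0.
  rewrite [4 * e * (_ / _)]mulrC divfK ?gt_eqF ?mulr_gt0 //.
  by rewrite /h mulrA.
have NhE : N%:R * h = M%:R * e.
  by rewrite /N /h natrM; field; rewrite gt_eqF.
have hrho : N.+1%:R * h <= M.+1%:R * e.
  by rewrite -!natr1 !mulrDl NhE !mul1r lerD2l.
have N1 : (1 < N)%N by rewrite /N (leq_trans k1) // leq_pmulr.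
have N0R : 0 < N%:R :> R by rewrite ltr0n ltnW.
have z01 : 0 <= (0 : R) <= 1 by rewrite lexx ler01.
have frho t : 0 <= t <= 1 -> dist p (f t) <= rho0 by exact: rho0P z01.
have fd t t' : 0 <= t <= 1 -> `|t - t'| <= d -> dist (f t) (f t') < e.
  exact: dP z01.
have jM01 j : (j <= M)%N -> 0 <= (j%:R / M%:R : R) <= 1.
  move=> jM; apply/andP; split; first by rewrite mulr_ge0 // invr_ge0 ltW.
  by rewrite ler_pdivrMr // mul1r ler_nat.
pose y (j : nat) := f (j%:R / M%:R).
have yq j : (M <= j)%N -> y j = q.
  by move=> Mj; apply: fq; rewrite ler_pdivlMr // mul1r ler_nat.
have yp : y 0%N = p by apply: fp; rewrite mul0r.
have yrho j : dist p (y j) <= rho0.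
  have [jM|/ltnW Mj] := leqP j M; first exact: frho (jM01 j jM).
  by rewrite yq // -(yq M) //; exact: frho (jM01 M (leqnn M)).
have ye j : dist (y j) (y j.+1) <= e.
  have [Mj|jM] := leqP M j; first by rewrite !yq ?mdistxx ?(ltW e0) // leqW.
  apply/ltW/fd; first exact: jM01 (ltnW jM).
  by rewrite -mulrBl -natr1 opprD addrA subrr add0r mulN1r normrN ger0_norm.
have Ty : tuples p q N h (refine k y) by exact: (refine_tuple good0 k0 er0).
pose T : set seqX := tuples p q N h; pose b (x : nat -> X) : R -> X := broken N x.
have bcurve x : T x -> curve_between 0 1 (b x) p q.
  exact: (broken_curve good1 h0 N1 hrho hr).
pose C : set seqX := T `&` [set x | hom p q f (b x)].
have fcurve : curve_between 0 1 f p q.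
  by split; [split; [exact: ltr01|exact: continuous_subspaceT]|exact: fp|exact: fq].
have Cy : C (refine k y).
  split=> //=; apply: (hom_near Xproper good0 fcurve (bcurve _ Ty)) => t t01.
  split; first exact: frho.
  case/andP: (t01) => t0 t1; have [i iN /andP[it ti]] := piece_index N1 t0 t1.
  have n1 := broken_near_node good1 h0 N1 hrho hr Ty it ti.
  have n2 := refine_near good0 k0 er0 yrho ye i.
  (* Piece [i] belongs to block [i %/ k], so [t] is within [1 / M] of the parameter of that
     sample. *)
  have n3 : dist (f t) (y (i %/ k)%N) < e.
    apply: fd => //; apply: le_trans Md.
    have j1 : (i %/ k)%N%:R <= M%:R * t.
      rewrite -(ler_pM2l k0R) mulrA -!natrM -/N; apply: le_trans it.
      by rewrite ler_nat mulnC leq_trunc_div.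
    have j2 : M%:R * t <= (i %/ k)%N%:R + 1.
      rewrite natr1 -(ler_pM2l k0R) mulrA -!natrM -/N; apply: le_trans ti _.
      by rewrite ler_nat mulnC ltn_ceil.
    rewrite -(ler_pM2l M0R) divff ?gt_eqF // -[X in X * _]gtr0_norm // -normrM.
    rewrite mulrBr [M%:R * (_ / _)]mulrC divfK ?gt_eqF //.
    by rewrite ler_norml; apply/andP; split; lra.
  have := metric_triangle (f t) (y (i %/ k)%N) (b (refine k y) t).
  have := metric_triangle (y (i %/ k)%N) (refine k y i) (b (refine k y) t).
  by move: he n1 n2 n3; rewrite /e /b; lra.
have homT x x' : T x -> T x' ->
    (forall t, 0 <= t <= 1 -> dist (b x t) (b x' t) <= r1) -> hom p q (b x) (b x').
  move=> Tx Tx' xx'; apply: (hom_near Xproper good1 (bcurve _ Tx) (bcurve _ Tx')).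
  move=> t /[dup] t01 /andP[t0 t1]; split; last exact: xx'.
  exact: (broken_region good1 h0 N1 hrho hr Tx t0 t1).
have cT : compact T by exact: compact_tuples.
(* Tuples near a limit of [C] have broken geodesics within [r1] of that of the limit, hence
   homotopic to it: the class is closed. *)
have cC : compact C.
  apply: (subclosed_compact _ cT); last by move=> x [].
  move=> x clx; have Tx : T x.
    apply: (compact_closed _ cT).
      by apply: hausdorff_product => _; exact: metric_hausdorff.
    by apply: closure_subset clx => z [].
  split=> //=; have [z [[Tz fz] zx]] :=
    clx _ (broken_near good1 h0 N1 hrho hr Xproper r10 Tx).
  apply: (hom_trans fz); apply/hom_sym/homT => // t t01.
  exact/ltW/zx.
have C0 : C !=set0 by exists (refine k y).
have [x] := compact_EVT_min C0 cC (continuous_subspaceT (@continuous_energy _ _ N)).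
rewrite inE => -[Tx fx] xmin.
have cx : critical N x.
  move=> i iN.
  have Trx : T (relax x i) by exact: (relax_tuple good1 h0 hrho hr).
  (* The node moves by at most [2 * h] and each curve is within [h] of its nodes, so the curves are
     at most [4 * h <= r1] apart and remain homotopic. *)
  have rC : C (relax x i).
    split=> //=; apply: (hom_trans fx); apply: homT => // t /andP[t0 t1].
    have [j jN /andP[jt tj]] := piece_index N1 t0 t1.
    have n1 := broken_near_node good1 h0 N1 hrho hr Tx jt tj.
    have n2 := broken_near_node good1 h0 N1 hrho hr Trx jt tj.
    have n3 : dist (x j) (relax x i j) <= 2 * h.
      rewrite /relax; case: (j =P i.+1) => [->|_]; last by rewrite mdistxx mulr_ge0.
      have [m1 _] := midpoint_edge good1 h0 hrho hr i Tx.
      have := metric_triangle (x i.+1) (x i) (gam (x i) (x i.+2) (1 / 2)).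
      have := metric_triangle (x i) (x i.+1) (x i.+2).
      have := tuple_edge i Tx; have := tuple_edge i.+1 Tx.
      by rewrite m1 (metric_sym (x i.+1) (x i)); lra.
    have := metric_triangle (b x t) (x j) (b (relax x i) t).
    have := metric_triangle (x j) (relax x i j) (b (relax x i) t).
    by rewrite (metric_sym (b x t) (x j)) /b; lra.
  have [rE rfix] := energy_relax good1 h0 hrho hr Tx iN.
  have rx : relax x i = x.
    by apply/rfix/eqP; rewrite eq_le rE; apply: xmin; rewrite inE.
  by have := congr1 (@^~ i.+1) rx; rewrite /relax eqxx.
exists (b x) => //; exists (N%:R * edge x 0); split.
- exact: (critical_local_geodesic good1 h0 N1 hrho hr Tx cx).
- exact: (broken0 good1 h0 N1 hrho hr Tx).
- exact: (broken1 good1 h0 N1 hrho hr Tx).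
Qed.

End Main.
Theorem theorem3p1 (R : realType) (X : metricType R)
  (Xproper : proper_space X)
  (Xlength : length_space X)
  (Xunique : locally_unique_geodesics X)
  (Xstable : forall (a b : R) (c : R -> X), geodesic_segment a b c -> stable a b c)
  (p q : X) (a0 b0 : R) (c0 : R -> X) (c0pq : curve_between a0 b0 c0 p q) :
  (exists (a b : R) (c : R -> X),
    [/\ geodesic_segment a b c, curve_between a b c p q
      & homotopic p q a0 b0 c0 a b c]) /\
  (forall (a b : R) (c : R -> X) (a' b' : R) (c' : R -> X),
    geodesic_segment a b c -> curve_between a b c p q ->
    homotopic p q a0 b0 c0 a b c ->
    geodesic_segment a' b' c' -> curve_between a' b' c' p q ->
    homotopic p q a0 b0 c0 a' b' c' ->
    reparameterization a b c a' b' c').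
Proof.
have [[ab0 cc0] c0a c0b] := c0pq; split.
  (* Extended by constants beyond [0, 1], in accordance with [hom]. *)
  pose f := c0 \o (fun t => line_path a0 b0 (clamp 0 1 t)).
  have cf : continuous f.
    apply: (continuous_comp_within cc0) => [|t].
      exact: continuous_compose (@continuous_clamp _ _ _) (@continuous_line_path _ _ _).
    by rewrite /= in_itv /= line_path_clamp // ltW.
  have [||g fg [l [gl g0 g1]]] :=
      hom_local_geodesic_exists Xproper Xlength Xunique (p := p) (q := q) cf.
  - by move=> t t0; rewrite /f /= clamp_l // line_path0.
  - by move=> t t1; rewrite /f /= clamp_r // line_path1.
  exists 0, 1, g; split.
  - exact: local_geodesic_segment gl.
  - by split=> //; exact: local_geodesic_curve gl.
  - apply: hom_homotopic; case: fg => H [cH H01 Hp Hq]; exists H; split=> // t t01.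
    case/andP: (t01) => t0 t1; have [-> ->] := H01 t t01.
    rewrite /f /= (clamp_id t0 t1); split=> //.
    by congr g; rewrite /line_path; ring.
move=> a b c a' b' c' gc [_ ca cb] cc gc' [_ ca' cb'] cc'.
have [psi cpsi [l cl]] := geodesic_constant_speed Xlength gc.
have [psi' cpsi' [l' cl']] := geodesic_constant_speed Xlength gc'.
(* The constant speed parameters witness the reparameterization: in them the two geodesics agree
   pointwise. The speeds [l] and [l'] may differ a priori. *)
exists psi, psi'; split=> // t; rewrite in_itv.
have [_ _ psi0 psi1] := cpsi; have [_ _ psi'0 psi'1] := cpsi'.
apply: (hom_local_geodesic_eq Xproper Xlength Xunique (p := p) (q := q) Xstable
  _ _ _ _ cl cl') => //=; rewrite ?psi0 ?psi1 ?psi'0 ?psi'1 //.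
have h1 : hom p q (c \o line_path a b) (c \o psi).
  by rewrite -ca -cb; apply: hom_reparam => //; case: gc.
have h2 : hom p q (c' \o line_path a' b') (c' \o psi').
  by rewrite -ca' -cb'; apply: hom_reparam => //; case: gc'.
apply: hom_trans (hom_sym h1) (hom_trans _ h2).
exact: hom_trans (hom_sym (homotopic_hom cc)) (homotopic_hom cc').
Qed.
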